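(* Let $0<\rho<1$, and let $B_1(0),B_\rho(0)\subset\mathbb{R}^n$ be the balls of radius $1$ and $\rho$ centered at the origin. Let $Q>0$ be a constant such that $\|u-u_{B_1(0)}\|_{L^2(B_1(0))}\le Q\|\nabla u\|_{L^2(B_1(0))}$ for every $u\in W^{1,2}(B_1(0))$, and let $K>0$ be a constant such that $\left\|\nabla u-\frac12(\nabla u-(\nabla u)^T)_{B_1(0)}\right\|_{L^2(B_1(0))}\le K\|\widehat\nabla u\|_{L^2(B_1(0))}$ for every $u\in W^{1,2}(B_1(0);\mathbb{R}^n)$, where $\widehat\nabla u=\frac12(\nabla u+(\nabla u)^T)$. For $u\in W^{1,2}(B_1(0);\mathbb{R}^n)$ set $$Tu(x)=u_{B_\rho(0)}+\tfrac12(\nabla u-(\nabla u)^T)_{B_\rho(0)}\,(x-x_{B_\rho(0)}).$$ Then the operator norm of $T$ on $W^{1,2}(B_1(0);\mathbb{R}^n)$ satisfies $\|T\|\le\sqrt{\frac{n+3}{n+2}}\left(\frac1\rho\right)^{\frac n2}$, and $$\|u-Tu\|_{W^{1,2}(B_1(0))}\le\left(1+\sqrt{\frac{n+3}{n+2}}\left(\frac1\rho\right)^{\frac n2}\right)K(1+Q^2)^{\frac12}\|\widehat\nabla u\|_{L^2(B_1(0))}\quad\text{for every }u\in W^{1,2}(B_1(0);\mathbb{R}^n).$$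
   Context: For a measurable set $F$ of positive measure, $f_F=\frac{1}{|F|}\int_F f$ denotes the average of $f$ over $F$ (also for vector and matrix valued $f$), and $x_F=\frac{1}{|F|}\int_F x\,dx$ is the center of mass of $F$ (here $x_{B_\rho(0)}=0$). The gradient convention is $(\nabla u)_{ij}=\partial_ju_i$. Norms: $\|u\|_{W^{1,2}(\Omega)}=\left(\int_\Omega |u|^2+|\nabla u|^2\right)^{1/2}$, with the Euclidean (Frobenius) norm on vectors and matrices. The constants $Q$ and $K$ exist by the classical Poincaré inequality and Korn inequality (of second kind). *)

(* Defs.v *)
From HB Require Import structures.
From mathcomp Require Import all_boot all_order all_algebra.
From mathcomp Require Import all_classical all_reals all_analysis.

Set Implicit Arguments.
Unset Strict Implicit.
Unset Printing Implicit Defensive.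
Import Order.TTheory GRing.Theory Num.Theory.
Import numFieldNormedType.Exports.
Local Open Scope classical_set_scope.
Local Open Scope ring_scope.

(* R^n is 'cV[R]_n, with the sigma-algebra generated by the coordinates, i.e.
   the Borel sigma-algebra. *)
Section measurable_cV.
Context {R : realType} (n : nat).

Let coors : 'I_n -> 'cV[R]_n -> R := fun i x => x i ord0.

Let cV_set0 : g_sigma_preimage coors set0.
Proof. exact: sigma_algebra0. Qed.

Let cV_setC A : g_sigma_preimage coors A -> g_sigma_preimage coors (~` A).
Proof. exact: sigma_algebraC. Qed.

Let cV_bigcup (F : (set 'cV[R]_n)^nat) :
  (forall i, g_sigma_preimage coors (F i)) ->
  g_sigma_preimage coors (\bigcup_i (F i)).
Proof. exact: sigma_algebra_bigcup. Qed.

HB.instance Definition _ := @isMeasurable.Build default_measure_display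
  'cV[R]_n (g_sigma_preimage coors) cV_set0 cV_setC cV_bigcup.

End measurable_cV.

Lemma measurable_coor {R : realType} n (i : 'I_n) :
  measurable_fun [set: 'cV[R]_n] (fun x => x i ord0).
Proof.
move=> _ Y mY; rewrite setTI; apply: sub_sigma_algebra => /=.
rewrite -bigcup_seq/=; exists i => /=; first by rewrite mem_index_enum.
by exists Y => //; rewrite setTI.
Qed.

Lemma measurable_fun_coorP {R : realType} (d : measure_display)
    (T : measurableType d) n (f : T -> 'cV[R]_n) :
  measurable_fun [set: T] f <->
  forall i, measurable_fun [set: T] (fun t => f t i ord0).
Proof.
split=> [mf i|mf].
  exact: (measurableT_comp (measurable_coor i) mf).
apply: (@iffRL _ (g_sigma_preimage
    (fun i => (fun x : 'cV[R]_n => x i ord0) \o f) `<=` measurable)).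
  rewrite g_sigma_preimage_comp; split=> [mf' A [/= C preC <-]|prefS].
    exact: mf'.
  by move=> _ A mA; apply: prefS; exists A.
apply: smallest_sub; first exact: sigma_algebra_measurable.
case: n => [|n] in f mf *; first by rewrite big_ord0.
rewrite -bigcup_mkord_ord; apply: bigcup_sub => i Ii.
by move=> A [B mB <-]; exact: mf.
Qed.

Definition cV_cons {R : realType} n (p : 'cV[R]_n * R) : 'cV[R]_n.+1 :=
  col_mx (p.2%:M : 'cV[R]_1) p.1.

Lemma measurable_cV_cons {R : realType} n :
  measurable_fun [set: 'cV[R]_n * R] (@cV_cons R n).
Proof.
apply/measurable_fun_coorP => i.
have [j ij|j ij] := @splitP 1 n i.
- rewrite (_ : i = lshift n j); last exact: val_inj.
  rewrite (_ : (fun _ => _) = snd); first exact: measurable_snd.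
  apply/funext => p; rewrite [LHS](@col_mxEu _ 1 n 1 _ _ j ord0).
  by rewrite mxE ord1 eqxx.
- rewrite (_ : i = rshift 1 j); last exact: val_inj.
  rewrite (_ : (fun _ => _) = (fun x : 'cV[R]_n => x j ord0) \o fst).
    by apply: measurableT_comp; [exact: measurable_coor|exact: measurable_fst].
  by apply/funext => p; exact: (@col_mxEd _ 1 n 1 _ _ j ord0).
Qed.

(* n-dimensional Lebesgue measure: the unit mass for n = 0, and for n.+1 the
   image of lebesgue_cV n \x lebesgue_measure under cV_cons.  The long name is
   the generated measure structure on a pushforward; it takes the
   measurability proof as an argument, so it cannot be inferred. *)
Fixpoint lebesgue_cV {R : realType} (n : nat) :
    {measure set 'cV[R]_n -> \bar R} :=
  if n is m.+1 then
    measure_function_pushforward__canonical__measure_function_Measure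
      (lebesgue_cV m \x lebesgue_measure)%E (@measurable_cV_cons R m)
  else \d_(0 : 'cV[R]_0).

(* The library's norm on matrices is the sup norm, hence fnorm and eball for
   the Euclidean (Frobenius) norm and the open Euclidean balls at the origin. *)
Definition fnorm {R : realType} m n (A : 'M[R]_(m, n)) : R :=
  Num.sqrt (\sum_i \sum_j A i j ^+ 2).

Definition eball {R : realType} n (r : R) : set 'cV[R]_n :=
  [set x | fnorm x < r].
Arguments eball {R} n r.

Section averages.
Context {R : realType} {n : nat}.
Implicit Types (F : set 'cV[R]_n).

Definition avg F (f : 'cV[R]_n -> R) : R :=
  (fine (lebesgue_cV n F))^-1 * \int[lebesgue_cV n]_(x in F) f x.

Definition avg_mx p q F (f : 'cV[R]_n -> 'M[R]_(p, q)) : 'M[R]_(p, q) :=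
  \matrix_(i, j) avg F (fun x => f x i j).

Definition center_of_mass F : 'cV[R]_n := avg_mx F id.

End averages.

Section sobolev.
Context {R : realType} {n : nat}.
Implicit Types (Omega : set 'cV[R]_n) (f g phi : 'cV[R]_n -> R).

Definition basis_vec (j : 'I_n) : 'cV[R]_n := delta_mx j ord0.

Definition partial (j : 'I_n) f : 'cV[R]_n -> R := 'D_(basis_vec j) f.

Definition smooth f : Prop :=
  forall s : seq 'I_n, let fs := foldr partial f s in
    continuous fs /\ forall j x, derivable fs x (basis_vec j).

Definition tsupport phi : set 'cV[R]_n := closure [set x | phi x != 0].

Definition test_function Omega phi : Prop :=
  [/\ smooth phi, compact (tsupport phi) & tsupport phi `<=` Omega].

Definition L2 Omega f : Prop :=
  measurable_fun Omega f /\
  (\int[lebesgue_cV n]_(x in Omega) ((f x ^+ 2)%:E) < +oo)%E.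

Definition L2norm Omega f : R :=
  Num.sqrt (\int[lebesgue_cV n]_(x in Omega) (f x ^+ 2)).

Definition is_weak_partial Omega f (j : 'I_n) g : Prop :=
  forall phi, test_function Omega phi ->
    \int[lebesgue_cV n]_(x in Omega) (f x * partial j phi x) =
    - \int[lebesgue_cV n]_(x in Omega) (g x * phi x).

Definition W12 Omega f : Prop :=
  L2 Omega f /\
  forall j, exists2 g, L2 Omega g & is_weak_partial Omega f j g.

(* A representative of the weak derivative, which is unique up to a null set
   of Omega; junk outside W12 and outside Omega. *)
Definition weak_partial Omega f (j : 'I_n) : 'cV[R]_n -> R :=
  xget (cst 0) [set g | L2 Omega g /\ is_weak_partial Omega f j g].

Definition weak_grad Omega f (x : 'cV[R]_n) : 'rV[R]_n :=
  \row_j weak_partial Omega f j x.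

Implicit Types (m : nat).

Definition W12v m Omega (u : 'cV[R]_n -> 'cV[R]_m) : Prop :=
  forall i, W12 Omega (fun x => u x i ord0).

Definition weak_gradv m Omega (u : 'cV[R]_n -> 'cV[R]_m) (x : 'cV[R]_n) :
    'M[R]_(m, n) :=
  \matrix_(i, j) weak_partial Omega (fun y => u y i ord0) j x.

Definition L2norm_mx p q Omega (F : 'cV[R]_n -> 'M[R]_(p, q)) : R :=
  L2norm Omega (fun x => fnorm (F x)).

Definition W12norm m Omega (u : 'cV[R]_n -> 'cV[R]_m) : R :=
  Num.sqrt (\int[lebesgue_cV n]_(x in Omega)
    (fnorm (u x) ^+ 2 + fnorm (weak_gradv Omega u x) ^+ 2)).

Definition W12opnorm m Omega
    (T : ('cV[R]_n -> 'cV[R]_m) -> ('cV[R]_n -> 'cV[R]_m)) : \bar R :=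
  ereal_sup [set (W12norm Omega (T u))%:E | u in
    [set u | W12v Omega u /\ W12norm Omega u <= 1]].

Definition sym_grad Omega (u : 'cV[R]_n -> 'cV[R]_n) (x : 'cV[R]_n) : 'M[R]_n :=
  2^-1 *: (weak_gradv Omega u x + (weak_gradv Omega u x)^T).

(* 1/2 (grad u - (grad u)^T)_F, where grad u is the weak gradient on Omega. *)
Definition avg_skew_grad Omega F (u : 'cV[R]_n -> 'cV[R]_n) : 'M[R]_n :=
  2^-1 *: avg_mx F (fun x => weak_gradv Omega u x - (weak_gradv Omega u x)^T).

Definition rigid_proj Omega F (u : 'cV[R]_n -> 'cV[R]_n) (x : 'cV[R]_n) :
    'cV[R]_n :=
  avg_mx F u + avg_skew_grad Omega F u *m (x - center_of_mass F).

End sobolev.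

(* Main.v *)
From HB Require Import structures.
From mathcomp Require Import all_boot all_order all_algebra.
From mathcomp Require Import all_classical all_reals all_analysis.
From mathcomp Require Import measurable_realfun ring lra.
Require Import Defs.

Set Implicit Arguments.
Unset Strict Implicit.
Unset Printing Implicit Defensive.
Import Order.TTheory GRing.Theory Num.Theory.
Import numFieldNormedType.Exports.
Local Open Scope classical_set_scope.
Local Open Scope ring_scope.

(* The weak gradient of an affine map [x |-> c + S x] is [S], and by symmetry
   of the ball [int_B x_i = int_B x_i x_k = 0] for [i != k] and
   [int_B x_i^2 = |B| / (n + 2)] (integrate the derivatives of functions
   vanishing on the sphere).  Hence the squared [W^{1,2}] norm of a rigid motion
   is [|B| (|c|^2 + (n + 3) / (n + 2) |S|^2)], and Jensen's inequality on
   [B_rho], with [|B_rho| = rho^n |B_1|], bounds [T].  Since [T] fixes rigid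
   motions, [u - T u = v - T v] for [v = u - P u] with [P] the projection
   defined by averages over [B_1], and Korn and Poincare bound [v].
   Weak partial derivatives are arbitrary representatives, so everything rests
   on their uniqueness: smooth bumps converge to the indicators of
   [B_1 /\ {x | forall i, a_i < x_i}], and these orthants form a pi-system
   generating the Borel sets. *)

(** The factor [(n + 3) / (n + 2)] is [1 + 1 / (n + 2)]: the constant gradient [S] of a rigid motion
    contributes [1], and the second moments of the ball contribute [1 / (n + 2)]. The factor
    [1 + Q^2] arises because Poincare bounds the mean-free field [v] by its gradient, and [grad v]
    is exactly the left side of Korn's inequality for [u]. All estimates are between squared norms,
    which are sums over components and entries. The triangle inequality for [v - T v] is replaced by
    the weighted bound [(a - b)^2 <= (1 + s) a^2 + (1 + s^-1) b^2] at [s = C]; since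
    [(1 + C) + (1 + C^-1) C^2 = (1 + C)^2], nothing is lost in the constant. The moments of the ball
    and integration by parts against test functions rest on one statement: a bounded function of
    bounded support whose integral along every line of one coordinate direction is zero has integral
    zero. *)

(** * Fubini and Tonelli for n-dimensional Lebesgue measure *)

Section lebesgue_cV_product.
Context {R : realType}.
Implicit Types n : nat.

(** Sup-norm cubes serve as bounded sets of finite measure, because their preimage under [cV_cons]
    is again a product. *)
Definition cube n (M : R) : set 'cV[R]_n := [set x | forall i, `|x i ord0| <= M].
Arguments cube : clear implicits.

Lemma measurable_box n (A : 'I_n -> set R) : (forall i, measurable (A i)) ->
  measurable [set x : 'cV[R]_n | forall i, A i (x i ord0)].
Proof.
move=> mA.
rewrite (_ : mkset _ =
    \big[setI/setT]_(i < n) ((fun x : 'cV[R]_n => x i ord0) @^-1` A i)).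
  apply: bigsetI_measurable => i _; rewrite -[X in measurable X]setTI.
  exact: measurable_coor.
rewrite -bigcap_seq/=; apply/seteqP; split=> [x Ax i _|x Ax i] //=.
by apply: Ax; rewrite /= mem_index_enum.
Qed.

Lemma measurable_cube n M : measurable (cube n M).
Proof.
apply: (@measurable_box n (fun=> [set t | `|t| <= M])) => _.
rewrite (_ : mkset _ = `[- M, M]%classic); first exact: measurable_itv.
by apply/seteqP; split=> t /=; rewrite in_itv/= ler_norml.
Qed.

Lemma cV_cons0 n (p : 'cV[R]_n * R) : cV_cons p ord0 ord0 = p.2.
Proof.
rewrite (_ : ord0 = lshift n (ord0 : 'I_1)); last exact: val_inj.
by rewrite [LHS](@col_mxEu _ 1 n 1) mxE eqxx.
Qed.

Lemma cV_consS n (p : 'cV[R]_n * R) i : cV_cons p (lift ord0 i) ord0 = p.1 i ord0.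
Proof.
rewrite (_ : lift ord0 i = rshift 1 i); last exact: val_inj.
exact: (@col_mxEd _ 1 n 1).
Qed.

Lemma lebesgue_cV_cube_lty n M : (@lebesgue_cV R n (cube n M) < +oo)%E.
Proof.
elim: n => [|n IH] /=.
  by rewrite diracE; case: (_ \in _); rewrite ltry.
rewrite /pushforward.
have -> : @cV_cons R n @^-1` cube n.+1 M = cube n M `*` `[- M, M]%classic.
  apply/seteqP; split=> [[x t] /= H|[x t] /= [H1 H2] i].
    split=> [i|]; first by have := H (lift ord0 i); rewrite cV_consS.
    by have := H ord0; rewrite cV_cons0/= in_itv/= ler_norml.
  case: (unliftP ord0 i) => [j ->|->]; first by rewrite cV_consS; exact: H1.
  by rewrite cV_cons0/= ler_norml; move: H2; rewrite in_itv.
rewrite product_measure1E//; last exact: measurable_cube.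
apply: lte_mul_pinfty => //.
  by rewrite ge0_fin_numE.
have /= -> := lebesgue_measure_itv `[- M, M]; case: ifP => // _; exact: ltry.
Qed.

Lemma lebesgue_cV_sigma_finite n : sigma_finite setT (@lebesgue_cV R n).
Proof.
exists (fun k => cube n k%:R) => [|k].
  apply/seteqP; split=> // x _.
  exists (Num.truncn (`|x|)).+1 => // i.
  apply: le_trans (ltW (truncnS_gt _)).
  rewrite [leRHS]/Num.norm/= mx_normrE.
  exact: (@le_bigmax _ _ _ _ (fun ij => `|x ij.1 ij.2|) (i, ord0)).
by split; [exact: measurable_cube | exact: lebesgue_cV_cube_lty].
Qed.

(** The same measure packed with the sigma-finiteness that Fubini and Tonelli require; it is
    convertible to [lebesgue_cV n]. *)
Definition lebesgue_cV_sf n : {sigma_finite_measure set 'cV[R]_n -> \bar R} :=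
  HB.pack_for (SigmaFiniteMeasure.type 'cV[R]_n R)
    (Measure.sort (@lebesgue_cV R n))
    (isSFinite.Build _ _ _ _
      (sfinite_measure_sigma_finite (lebesgue_cV_sigma_finite n)))
    (isSigmaFinite.Build _ _ _ _ (lebesgue_cV_sigma_finite n)).

Lemma measurable_cV_cons_l n (x : 'cV[R]_n) :
  measurable_fun [set: R] (fun t : R => cV_cons (x, t)).
Proof.
exact: (measurableT_comp (@measurable_cV_cons R n) (pair1_measurable x)).
Qed.

Lemma measurable_cV_cons_r n (t : R) :
  measurable_fun [set: 'cV[R]_n] (fun x => cV_cons (x, t)).
Proof.
exact: (measurableT_comp (@measurable_cV_cons R n) (pair2_measurable t)).
Qed.

Local Open Scope ereal_scope.

(** Convertible to the product inside [lebesgue_cV n.+1], hence the trivial proof of [lebesgue_cVS],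
    yet with a sigma-finite left factor. *)
Let lebesgue_cVM n : {measure set ('cV[R]_n * measurableTypeR R) -> \bar R} :=
  (lebesgue_cV_sf n \x lebesgue_measure).

Let lebesgue_cVS n : (lebesgue_cV n.+1 : set 'cV[R]_n.+1 -> \bar R) =
  pushforward (lebesgue_cVM n) (@cV_cons R n).
Proof. by []. Qed.

Lemma ge0_integral_lebesgue_cVS n (f : 'cV[R]_n.+1 -> \bar R) :
  measurable_fun [set: 'cV[R]_n.+1] f -> (forall x, 0 <= f x) ->
  \int[lebesgue_cV n.+1]_x f x =
  \int[lebesgue_cV n]_x \int[lebesgue_measure]_t f (cV_cons (x, t)).
Proof.
move=> mf f0; rewrite lebesgue_cVS.
have f0' : {in [set: 'cV[R]_n.+1], forall y, 0 <= f y} by move=> y _; exact: f0.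
rewrite (@ge0_integral_pushforward _ _ ('cV[R]_n * measurableTypeR R)%type _ _
  (@cV_cons R n) (@measurable_cV_cons R n)
  (lebesgue_cVM n) setT f measurableT mf f0').
rewrite preimage_setT.
apply: (@fubini_tonelli1 _ _ _ _ _ (lebesgue_cV_sf n) lebesgue_measure
  (f \o @cV_cons R n)) => [|p]; last exact: f0.
exact: measurableT_comp mf (@measurable_cV_cons R n).
Qed.

Lemma integrable_lebesgue_cVS n (f : 'cV[R]_n.+1 -> \bar R) :
  (lebesgue_cV n.+1).-integrable setT f ->
  (lebesgue_cVM n).-integrable setT (f \o @cV_cons R n).
Proof.
move=> /integrableP[mf]; rewrite lebesgue_cVS => fi; apply/integrableP; split.
  exact: measurableT_comp mf (@measurable_cV_cons R n).
have af0 : {in [set: 'cV[R]_n.+1], forall y, 0 <= (abse \o f) y}.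
  by move=> y _; exact: abse_ge0.
apply: le_lt_trans fi.
rewrite (@ge0_integral_pushforward _ _ ('cV[R]_n * measurableTypeR R)%type _ _
  (@cV_cons R n) (@measurable_cV_cons R n)
  (lebesgue_cVM n) setT (abse \o f) measurableT _ af0)//.
exact: measurableT_comp.
Qed.

Let integral_lebesgue_cV_pushforward n (f : 'cV[R]_n.+1 -> \bar R) :
  (lebesgue_cV n.+1).-integrable setT f ->
  \int[lebesgue_cV n.+1]_x f x =
  \int[lebesgue_cVM n]_x (f \o @cV_cons R n) x.
Proof.
move=> fi; have fi' := integrable_lebesgue_cVS fi.
rewrite lebesgue_cVS.
rewrite (@integral_pushforward _ _ ('cV[R]_n * measurableTypeR R)%type _ _
  (@cV_cons R n) (@measurable_cV_cons R n)
  (lebesgue_cVM n) setT f)//.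
exact: measurable_int fi.
Qed.

Lemma integral_lebesgue_cVS n (f : 'cV[R]_n.+1 -> \bar R) :
  (lebesgue_cV n.+1).-integrable setT f ->
  \int[lebesgue_cV n.+1]_x f x =
  \int[lebesgue_cV n]_x \int[lebesgue_measure]_t f (cV_cons (x, t)).
Proof.
move=> fi; have fi' := integrable_lebesgue_cVS fi.
rewrite integral_lebesgue_cV_pushforward//.
exact/esym/(@integral12_prod_meas1 _ _ _ _ _ (lebesgue_cV_sf n)
  lebesgue_measure).
Qed.

(** The order of integration suited to directions other than the first: for fixed [t] the inner
    integral lives in dimension [n], where an induction hypothesis applies. *)
Lemma integral_lebesgue_cVS_swap n (f : 'cV[R]_n.+1 -> \bar R) :
  (lebesgue_cV n.+1).-integrable setT f ->
  \int[lebesgue_cV n.+1]_x f x =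
  \int[lebesgue_measure]_t \int[lebesgue_cV n]_x f (cV_cons (x, t)).
Proof.
move=> fi; have fi' := integrable_lebesgue_cVS fi.
rewrite integral_lebesgue_cV_pushforward//.
exact/esym/(@integral21_prod_meas1 _ _ _ _ _ (lebesgue_cV_sf n)
  lebesgue_measure).
Qed.

End lebesgue_cV_product.
Arguments cube {R} n M.
Arguments lebesgue_cV_sf {R} n.

(** * Integration along coordinate lines *)

Section lebesgue_cV_lines.
Context {R : realType}.
Implicit Types n : nat.

Lemma integrable_bounded_support n (D : set 'cV[R]_n) (f : 'cV[R]_n -> R) (C : R) :
  measurable D -> (lebesgue_cV n D < +oo)%E -> measurable_fun [set: 'cV[R]_n] f ->
  (forall x, `|f x| <= C) -> (forall x, ~ D x -> f x = 0) ->
  (lebesgue_cV n).-integrable setT (EFin \o f).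
Proof.
move=> mD Doo mf fC f0.
have -> : EFin \o f = (EFin \o f) \_ D.
  apply/funext => x; rewrite patchE; case: ifPn => //.
  by rewrite notin_setE => /f0 /= ->.
apply/integrable_restrict => //; rewrite setTI.
apply: measurable_bounded_integrable => //; first exact: measurable_funTS.
exists C; split; first exact: num_real.
by move=> c Cc x _; apply: (le_trans (fC x)); exact: ltW.
Qed.

(** The line through [x] in direction [j], parametrized by the value of the coordinate and not by an
    increment, so that it commutes with [cV_cons]. *)
Definition set_coor n (j : 'I_n) (x : 'cV[R]_n) (t : R) : 'cV[R]_n :=
  \col_i (if i == j then t else x i ord0).

Lemma set_coor_cons0 n (x : 'cV[R]_n) s t :
  set_coor ord0 (cV_cons (x, s)) t = cV_cons (x, t).
Proof.
apply/colP => i; rewrite mxE; case: (unliftP ord0 i) => [j ->|->].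
  by rewrite !cV_consS.
by rewrite eqxx cV_cons0.
Qed.

Lemma set_coor_consS n (j : 'I_n) (x : 'cV[R]_n) s t :
  set_coor (lift ord0 j) (cV_cons (x, s)) t = cV_cons (set_coor j x t, s).
Proof.
apply/colP => i; rewrite mxE; case: (unliftP ord0 i) => [k ->|->].
  by rewrite !cV_consS /= mxE (inj_eq lift_inj).
by rewrite !cV_cons0.
Qed.

(* A Fubini argument along one fixed direction; bounded support makes every
   section integrable, so that no null set of lines has to be discarded. *)
Lemma integral_lines_eq0 n (j : 'I_n) (f : 'cV[R]_n -> R) (M C : R) :
  measurable_fun [set: 'cV[R]_n] f -> (forall x, `|f x| <= C) ->
  (forall x, ~ cube n M x -> f x = 0) ->
  (forall x, \int[lebesgue_measure]_t (f (set_coor j x t))%:E = 0)%E ->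
  (\int[lebesgue_cV n]_x (f x)%:E = 0)%E.
Proof.
elim: n j f => [[]//|n IH] j f mf fC f0 fl.
have fi : (lebesgue_cV n.+1).-integrable setT (EFin \o f).
  apply: (@integrable_bounded_support _ (cube n.+1 M) _ C) => //.
    exact: measurable_cube.
  exact: lebesgue_cV_cube_lty.
(* A direction other than the first stays inside each slice with fixed first coordinate, where the
   induction hypothesis applies. In the first direction the inner integral is itself the line
   integral. *)
case: (unliftP ord0 j) => [k jk|j0].
  rewrite (integral_lebesgue_cVS_swap fi).
  apply: integral0_eq => t _ /=; apply: (IH k) => //.
  - exact: (measurableT_comp mf (measurable_cV_cons_r t)).
  - move=> x xM; apply: f0 => H; apply: xM => i.
    by have := H (lift ord0 i); rewrite cV_consS.
  - by move=> x; rewrite -[RHS](fl (cV_cons (x, t))) jk;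
      apply: eq_integral => s _; rewrite set_coor_consS.
rewrite (integral_lebesgue_cVS fi); apply: integral0_eq => x _ /=.
rewrite -[RHS](fl (cV_cons (x, 0))) j0.
by apply: eq_integral => s _; rewrite set_coor_cons0.
Qed.

Lemma integral_is_derive (F f : R -> R) (a b : R) : a < b -> continuous f ->
  (forall x, is_derive x (1 : R) F (f x)) ->
  (\int[lebesgue_measure]_(t in `[a, b]) (f t)%:E = (F b - F a)%:E)%E.
Proof.
move=> ab cf dF.
have cF : continuous F.
  by move=> x; apply/differentiable_continuous/derivable1_diffP; case: (dF x).
rewrite EFinB; apply: continuous_FTC2 => //.
- exact: continuous_subspaceT.
- split.
  + by move=> x _; case: (dF x).
  + exact/cvg_at_right_filter/cF.
  + exact/cvg_at_left_filter/cF.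
- by move=> x _; rewrite derive1E; case: (dF x).
Qed.

Lemma integral_is_derive_eq0 (F f : R -> R) (M : R) : continuous f ->
  (forall x, is_derive x (1 : R) F (f x)) ->
  (forall t, M <= `|t| -> F t = 0 /\ f t = 0) ->
  (\int[lebesgue_measure]_t (f t)%:E = 0)%E.
Proof.
(* [M] may be negative; this choice gives both [- N < N] and [M <= |N|]. *)
move=> cf dF H; pose N : R := `|M| + 1.
have MN : M <= `|N|.
  by rewrite ger0_norm ?addr_ge0//; apply: (le_trans (ler_norm _)); rewrite lerDl.
have N0 : 0 < N by rewrite ltr_pwDr.
transitivity (\int[lebesgue_measure]_(t in `[(- N)%R, N]) (f t)%:E)%E; last first.
  rewrite (integral_is_derive _ cf dF); last by rewrite -subr_gt0 opprK addr_gt0.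
  by rewrite (H N MN).1 (H (- N) _).1 ?subr0// normrN.
rewrite [RHS]integral_mkcond; apply: eq_integral => t _.
rewrite patchE; case: ifPn => //; rewrite notin_setE/= in_itv/= => /negP tN.
rewrite (H t _).2//; apply: contraNT tN; rewrite -ltNge => tM.
rewrite -ler_norml; apply: (le_trans (ltW tM)).
by apply: (le_trans MN); rewrite ger0_norm // ltW.
Qed.

(* The integrand is the derivative of a t (c - t^2) - b (c - t^2) / 2. *)
Lemma integral_ball_line_eq0 (a b c : R) :
  (\int[lebesgue_measure]_t
     ((if t ^+ 2 < c then a * (c - 3 * t ^+ 2) + b * t else 0))%:E = 0)%E.
Proof.
have [c0|c0] := leP c 0.
  apply: integral0_eq => t _; rewrite ltNge (le_trans c0) ?sqr_ge0//.
pose f t : R := a * (c - 3 * t ^+ 2) + b * t.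
(* The primitive [a t (c - t^2) - b (c - t^2) / 2] up to the constant [b c / 2]; it takes equal
   values at [s] and [- s]. *)
pose F t : R := a * (c * t - t ^+ 3) + b / 2 * t ^+ 2.
pose s := Num.sqrt c; have s0 : 0 < s by rewrite sqrtr_gt0.
have s2 : s ^+ 2 = c by rewrite sqr_sqrtr// ltW.
have cf : continuous f.
  move=> x; rewrite /f; apply: cvgD; apply: cvgM; try exact: cvg_cst; last exact: cvg_id.
  apply: cvgB; first exact: cvg_cst.
  by apply: cvgM; [exact: cvg_cst|exact: exprn_continuous].
have dF x : is_derive x (1 : R) F (f x).
  rewrite /F; apply: is_derive_eq.
  by rewrite /f /GRing.scale/=; field.
transitivity (\int[lebesgue_measure]_(t in `](- s)%R, s[) (f t)%:E)%E.
  rewrite [RHS]integral_mkcond; apply: eq_integral => t _.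
  rewrite patchE mem_setE in_itv/= -ltr_norml.
  have -> : (t ^+ 2 < c) = (`|t| < s).
    by rewrite -s2 -(real_normK (num_real t)) ltr_pXn2r ?nnegrE// ltW.
  by case: ifP.
have mf : measurable_fun [set: R] (EFin \o f).
  apply/measurable_EFinP. apply: continuous_measurable_fun. exact: cf.
rewrite integral_itv_bndo_bndc; last exact: measurable_funTS.
rewrite integral_itv_obnd_cbnd; last exact: measurable_funTS.
rewrite (integral_is_derive _ cf dF); last by rewrite -subr_gt0 opprK addr_gt0.
rewrite /F -s2; congr EFin; ring.
Qed.

End lebesgue_cV_lines.

(** * Finite sums of integrals *)

Section Rintegral_sum.
Context d (T : measurableType d) (R : realType).
Variables (mu : {measure set T -> \bar R}) (D : set T) (mD : measurable D).

Lemma integrable_EFin_sum (I : Type) (s : seq I) (f : I -> T -> R) :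
  (forall i, mu.-integrable D (EFin \o f i)) ->
  mu.-integrable D (EFin \o (fun x => \sum_(i <- s) f i x)).
Proof.
move=> fi; elim: s => [|i s IH].
  rewrite (_ : _ \o _ = cst 0%E); first exact: integrable0.
  by apply/funext => x /=; rewrite big_nil.
rewrite (_ : _ \o _ = (EFin \o f i) \+ (EFin \o (fun x => (\sum_(i <- s) f i x)%R)))%E.
  exact: integrableD.
by apply/funext => x /=; rewrite big_cons.
Qed.

Lemma Rintegral_sum (I : Type) (s : seq I) (f : I -> T -> R) :
  (forall i, mu.-integrable D (EFin \o f i)) ->
  \int[mu]_(x in D) (\sum_(i <- s) f i x) =
  \sum_(i <- s) \int[mu]_(x in D) f i x.
Proof.
move=> fi; elim: s => [|i s IH].
  rewrite big_nil; under eq_Rintegral do rewrite big_nil.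
  by rewrite Rintegral_cst// mul0r.
rewrite big_cons -IH -RintegralD//; last exact: integrable_EFin_sum.
by apply: eq_Rintegral => x _; rewrite big_cons.
Qed.

End Rintegral_sum.

(** * Moments and volume of Euclidean balls *)

Section euclidean_ball.
Context {R : realType}.
Implicit Types (n : nat) (r : R).

Lemma fnorm_sqr m n (A : 'M[R]_(m, n)) :
  fnorm A ^+ 2 = \sum_i \sum_j A i j ^+ 2.
Proof.
by rewrite sqr_sqrtr// sumr_ge0// => i _; rewrite sumr_ge0// => j _; exact: sqr_ge0.
Qed.

Lemma fnorm_col_sqr n (x : 'cV[R]_n) : fnorm x ^+ 2 = \sum_i x i ord0 ^+ 2.
Proof. by rewrite fnorm_sqr; apply: eq_bigr => i _; rewrite big_ord1. Qed.

Lemma eballE n r (x : 'cV[R]_n) : 0 < r ->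
  eball n r x = (\sum_i x i ord0 ^+ 2 < r ^+ 2) :> Prop.
Proof.
by move=> r0; rewrite -fnorm_col_sqr /eball/= ltr_pXn2r ?nnegrE ?sqrtr_ge0// ltW.
Qed.

Lemma eball_coor n r (x : 'cV[R]_n) i : eball n r x -> `|x i ord0| <= r.
Proof.
rewrite /eball/= => xr; have r0 : 0 < r by rewrite (le_lt_trans _ xr)// sqrtr_ge0.
rewrite -(@ler_pXn2r _ 2%N) ?nnegrE// ?ltW// real_normK ?num_real//.
have : eball n r x by [].
rewrite eballE//; apply: le_lt_trans.
by rewrite (bigD1 i)//= lerDl sumr_ge0// => j _; exact: sqr_ge0.
Qed.

Lemma measurable_fun_sqr_col n :
  measurable_fun [set: 'cV[R]_n] (fun x => \sum_i x i ord0 ^+ 2).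
Proof. by apply: measurable_sum => i; apply: measurable_funX; exact: measurable_coor. Qed.

Lemma measurable_eball n r : measurable (eball n r).
Proof.
have [r0|r0] := ltP 0 r; last first.
  rewrite (_ : eball n r = set0)// -subset0 => x /=.
  by rewrite /eball/= ltNge (le_trans r0)// sqrtr_ge0.
rewrite (_ : eball n r =
  setT `&` (fun x : 'cV[R]_n => \sum_i x i ord0 ^+ 2) @^-1` `]-oo, r ^+ 2[%classic).
  by apply: measurable_fun_sqr_col => //; exact: measurable_itv.
by rewrite setTI; apply/seteqP; split=> x /=; rewrite eballE// in_itv.
Qed.

Arguments measurable_eball : clear implicits.

Lemma lebesgue_eball_lty n r : (lebesgue_cV n (eball n r) < +oo)%E.
Proof.
apply: le_lt_trans (lebesgue_cV_cube_lty n r).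
apply: le_measure; rewrite ?inE; first exact: measurable_eball.
  exact: measurable_cube.
by move=> x xr i; exact: eball_coor.
Qed.

Lemma integrable_eball n r (f : 'cV[R]_n -> R) (C : R) :
  measurable_fun (eball n r) f -> (forall x, eball n r x -> `|f x| <= C) ->
  (lebesgue_cV n).-integrable (eball n r) (EFin \o f).
Proof.
move=> mf fC; apply: measurable_bounded_integrable => //.
- exact: measurable_eball.
- exact: lebesgue_eball_lty.
exists C; split; first exact: num_real.
by move=> c Cc x xB; apply: (le_trans (fC x xB)); exact: ltW.
Qed.

Lemma integrable_eball_coor n r i :
  (lebesgue_cV n).-integrable (eball n r) (EFin \o (fun x : 'cV[R]_n => x i ord0)).
Proof.
apply: (@integrable_eball _ _ _ r) => [|x]; last exact: eball_coor.
by apply: measurable_funTS; exact: measurable_coor.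
Qed.

Lemma integrable_eball_coorM n r i k :
  (lebesgue_cV n).-integrable (eball n r) (EFin \o (fun x : 'cV[R]_n => x i ord0 * x k ord0)).
Proof.
apply: (@integrable_eball _ _ _ (r * r)) => [|x xB].
  by apply: measurable_funTS; apply: measurable_funM; exact: measurable_coor.
by rewrite normrM ler_pM//; exact: eball_coor.
Qed.

(* Integrating the [i]-th derivative of [(r^2 - |x|^2) (a x_i - b / 2)], which
   vanishes on the sphere; [b] does not depend on [x_i]. *)
Lemma Rintegral_eball_eq0 n r i (a : R) (b : 'cV[R]_n -> R) (C : R) : 0 < r ->
  measurable_fun [set: 'cV[R]_n] b -> (forall x, eball n r x -> `|b x| <= C) ->
  (forall x t, b (set_coor i x t) = b x) ->
  \int[lebesgue_cV n]_(x in eball n r)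
    (a * (r ^+ 2 - \sum_k x k ord0 ^+ 2 - 2 * x i ord0 ^+ 2)
     + b x * x i ord0) = 0.
Proof.
move=> r0 mb bC bi.
pose g (x : 'cV[R]_n) := a * (r ^+ 2 - \sum_k x k ord0 ^+ 2 - 2 * x i ord0 ^+ 2)
     + b x * x i ord0.
have mg : measurable_fun [set: 'cV[R]_n] g.
  apply: measurable_funD; apply: measurable_funM => //; last exact: measurable_coor.
  apply: measurable_funB.
    by apply: measurable_funB => //; exact: measurable_fun_sqr_col.
  by apply: measurable_funM => //; apply: measurable_funX; exact: measurable_coor.
rewrite Rintegral_mkcond /Rintegral.
under eq_integral do rewrite -/(g _).
rewrite (@integral_lines_eq0 _ _ i (g \_ (eball n r)) r (`|a| * (3 * r ^+ 2) + `|C| * r))//.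
- apply/(measurable_restrictT g (measurable_eball n r)).
  exact: measurable_funTS.
- move=> x; rewrite patchE; case: ifPn => [|_]; last first.
    by rewrite normr0 addr_ge0// mulr_ge0// ?mulr_ge0// ?sqr_ge0// ltW.
  rewrite inE => xB; apply: (le_trans (ler_normD _ _)); rewrite !normrM lerD//.
    rewrite ler_wpM2l//.
    have := xB; rewrite eballE// => xr.
    have x0 : 0 <= \sum_k x k ord0 ^+ 2 by rewrite sumr_ge0// => k _; exact: sqr_ge0.
    have xi : x i ord0 ^+ 2 <= \sum_k x k ord0 ^+ 2.
      by rewrite (bigD1 i)//= lerDl sumr_ge0// => j _; exact: sqr_ge0.
    have xi0 := sqr_ge0 (x i ord0).
    rewrite ler_norml; apply/andP; split; lra.
  by rewrite ler_pM//; [exact: (le_trans (bC _ xB)) (ler_norm _)|exact: eball_coor].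
- move=> x xr; rewrite patchE; case: ifPn => //; rewrite inE => xB.
  by exfalso; apply: xr => k; exact: eball_coor.
(* On this line [r^2 - |x|^2 - 2 t^2] equals [c - 3 t^2], where [c] is [r^2] minus the squares of
   the other coordinates. *)
- move=> x; rewrite -[RHS](integral_ball_line_eq0 a (b x)
    (r ^+ 2 - \sum_(k | k != i) x k ord0 ^+ 2)).
  apply: eq_integral => t _; congr EFin; rewrite patchE.
  have E : \sum_k set_coor i x t k ord0 ^+ 2 =
      t ^+ 2 + \sum_(k | k != i) x k ord0 ^+ 2.
    rewrite (bigD1 i)//= mxE eqxx; congr (_ + _).
    by apply: eq_bigr => k /negPf ki; rewrite mxE ki.
  have -> : (set_coor i x t \in eball n r) =
      (t ^+ 2 < r ^+ 2 - \sum_(k | k != i) x k ord0 ^+ 2).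
    by apply/idP/idP; rewrite inE eballE// E ltrBrDr.
  by case: ifP => // _; rewrite /g E bi mxE eqxx; ring.
Qed.

Lemma Rintegral_eball_coor n r i : 0 < r ->
  \int[lebesgue_cV n]_(x in eball n r) x i ord0 = 0.
Proof.
move=> r0; rewrite -[RHS](@Rintegral_eball_eq0 n r i 0 (fun=> 1) 1 r0)//.
  by apply: eq_Rintegral => x _; rewrite mul0r add0r mul1r.
by move=> x _; rewrite normr1.
Qed.

Lemma Rintegral_eball_coorM n r i k : 0 < r -> i != k ->
  \int[lebesgue_cV n]_(x in eball n r) (x i ord0 * x k ord0) = 0.
Proof.
move=> r0 ik.
rewrite -[RHS](@Rintegral_eball_eq0 n r i 0 (fun x => x k ord0) r r0).
- by apply: eq_Rintegral => x _; rewrite mul0r add0r mulrC.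
- exact: measurable_coor.
- by move=> x; exact: eball_coor.
- by move=> x t; rewrite mxE eq_sym (negPf ik).
Qed.

(** With [a = 1] and [b = 0], the vanishing integral reads [r^2 V - sum_l m_l - 2 m_k = 0] for each
    second moment [m_k]. This forces all [m_k] to be equal, without rotations, and then
    [(n + 2) m_k = r^2 V]. *)
Lemma Rintegral_eball_coor_sqr n r i : 0 < r ->
  \int[lebesgue_cV n]_(x in eball n r) (x i ord0 ^+ 2) =
  r ^+ 2 * fine (lebesgue_cV n (eball n r)) / (n%:R + 2).
Proof.
move=> r0; set V := fine _.
have mB := measurable_eball n r.
have i2 k : (lebesgue_cV n).-integrable (eball n r) (EFin \o (fun x : 'cV[R]_n => x k ord0 ^+ 2)).
  exact: integrable_eball_coorM.
pose m k := \int[lebesgue_cV n]_(x in eball n r) (x k ord0 ^+ 2).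
have E k : r ^+ 2 * V - \sum_l m l - 2 * m k = 0.
  rewrite -[RHS](@Rintegral_eball_eq0 n r k 1 (fun=> 0) 0 r0)//; last first.
    by move=> x _; rewrite normr0.
  have -> : \sum_l m l =
      \int[lebesgue_cV n]_(x in eball n r) (\sum_l x l ord0 ^+ 2).
    by rewrite Rintegral_sum.
  have -> : r ^+ 2 * V = \int[lebesgue_cV n]_(x in eball n r) (r ^+ 2).
    by rewrite Rintegral_cst.
  rewrite /m -RintegralZl//.
  have ic : (lebesgue_cV n).-integrable (eball n r) (EFin \o (fun=> r ^+ 2)).
    by apply: (@integrable_eball _ _ _ `|r ^+ 2|).
  have isq : (lebesgue_cV n).-integrable (eball n r)
      (EFin \o (fun x : 'cV[R]_n => \sum_l x l ord0 ^+ 2)) by exact: integrable_EFin_sum.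
  rewrite -RintegralB// -RintegralB//.
  - by apply: eq_Rintegral => x _; rewrite mul1r mul0r addr0.
  - exact: (integrableB mB ic isq).
  - exact: (integrableZl mB 2 (i2 k)).
have mE k : m k = m i by have := E k; have := E i; lra.
have := E i; under eq_bigr do rewrite mE.
rewrite sumr_const card_ord => H.
have n2 : n%:R + 2 != 0 :> R by rewrite gt_eqF// ltr_wpDl.
rewrite -/(m i); rewrite -[LHS](mulfK n2); congr (_ / _).
by rewrite mulrDr; lra.
Qed.

(** [k] times the image of Lebesgue measure under [t |-> k t] gives each interval []a, b]] its
    length, so it is Lebesgue measure by uniqueness; the claim is integration against this image. *)
Lemma lebesgue_measure_scale (k : R) (f : R -> \bar R) : 0 < k ->
  measurable_fun [set: R] f -> (forall t, 0 <= f t)%E ->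
  (k%:E * \int[lebesgue_measure]_t f (k * t)%R = \int[lebesgue_measure]_t f t)%E.
Proof.
move=> k0 mf f0.
pose sc : measurableTypeR R -> measurableTypeR R := fun t => k * t.
have mk : measurable_fun [set: measurableTypeR R] sc by exact: measurable_funM.
pose p : {measure set (measurableTypeR R) -> \bar R} :=
  measure_function_pushforward__canonical__measure_function_Measure
    lebesgue_measure mk.
pose m : {measure set (measurableTypeR R) -> \bar R} := mscale (NngNum (ltW k0)) p.
have mE A : measurable A -> lebesgue_measure A = m A.
  apply: lebesgue_measure_unique => _ [[a b] _ <-] /=.
  rewrite /mscale/= /pushforward.
  have -> : sc @^-1` `]a, b]%classic = `]a / k, b / k]%classic.
    by apply/seteqP; split=> t /=; rewrite !in_itv/= ltr_pdivrMr// ler_pdivlMr//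
      (mulrC t).
  rewrite !lebesgue_measure_itv/= !lte_fin ltr_pM2r ?invr_gt0//.
  case: ifP => _; last by rewrite mule0.
  by rewrite -EFinM; congr EFin; field; rewrite gt_eqF.
rewrite [RHS](eq_measure_integral m); last by move=> A mA _; exact: mE.
rewrite ge0_integral_mscale//=.
by rewrite (@ge0_integral_pushforward _ _ _ _ _ _ mk lebesgue_measure setT f).
Qed.

(** By Tonelli each coordinate contributes one factor [k]. The intended integrand is the indicator
    of a ball, hence the restriction to nonnegative functions. *)
Lemma lebesgue_cV_scale n (k : R) (f : 'cV[R]_n -> \bar R) : 0 < k ->
  measurable_fun [set: 'cV[R]_n] f -> (forall x, 0 <= f x)%E ->
  ((k ^+ n)%:E * \int[lebesgue_cV n]_x f (k *: x)%R =
   \int[lebesgue_cV n]_x f x)%E.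
Proof.
move=> k0; elim: n f => [|n IH] f mf f0.
  rewrite expr0 mul1e; apply: eq_integral => x _.
  by rewrite (flatmx0 x) scaler0.
have mfk : measurable_fun [set: 'cV[R]_n.+1] (fun x => f (k *: x)).
  apply: (measurableT_comp mf); apply/measurable_fun_coorP => i.
  rewrite (_ : (fun _ => _) = (fun x : 'cV[R]_n.+1 => k * x i ord0)).
    by apply: measurable_funM => //; exact: measurable_coor.
  by apply/funext => x; rewrite mxE.
rewrite !ge0_integral_lebesgue_cVS//.
have mg : measurable_fun [set: 'cV[R]_n]
    (fun x => \int[lebesgue_measure]_t f (cV_cons (x, t)))%E.
  apply: (@measurable_fun_fubini_tonelli_F _ _ 'cV[R]_n _ _ lebesgue_measure
    (f \o @cV_cons R n)).
    exact: (measurableT_comp mf (@measurable_cV_cons R n)).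
  by move=> p; exact: f0.
have g0 x : (0 <= \int[lebesgue_measure]_t f (cV_cons (x, t)))%E.
  by apply: integral_ge0.
rewrite -(IH _ mg g0) exprSr EFinM -muleA; congr (_ * _)%E.
rewrite -ge0_integralZl//; last 3 first.
- apply: (@measurable_fun_fubini_tonelli_F _ _ 'cV[R]_n _ _ lebesgue_measure
    ((fun x => f (k *: x)) \o @cV_cons R n)).
    exact: (measurableT_comp mfk (@measurable_cV_cons R n)).
  by move=> p; exact: f0.
- by move=> x _; apply: integral_ge0.
- by rewrite lee_fin ltW.
apply: eq_integral => x _.
rewrite -(@lebesgue_measure_scale _ (fun t => f (cV_cons (k *: x, t))) k0);
  last 2 first.
- exact: (measurableT_comp mf (measurable_cV_cons_l (k *: x))).
- by move=> t; exact: f0.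
congr (_ * _)%E; apply: eq_integral => t _; congr f.
apply/colP => i; rewrite mxE; case: (unliftP ord0 i) => [j ->|->].
  by rewrite !cV_consS /= mxE.
by rewrite !cV_cons0.
Qed.

Lemma lebesgue_eball_scale n r : 0 < r ->
  lebesgue_cV n (eball n r) = ((r ^+ n)%:E * lebesgue_cV n (eball n 1))%E.
Proof.
move=> r0; have mr := measurable_eball n r; have m1 := measurable_eball n (1 : R).
have volE (s : R) : lebesgue_cV n (eball n s) =
    (\int[lebesgue_cV n]_x (\1_(eball n s) x)%:E)%E.
  have ms := measurable_eball n s.
  by rewrite integral_indic// setIT.
rewrite !volE.
have m1r : measurable_fun [set: 'cV[R]_n] (EFin \o (\1_(eball n r) : 'cV[R]_n -> R)).
  by apply/measurable_EFinP; exact: measurable_indic.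
have ge0 x : (0 <= (EFin \o (\1_(eball n r) : 'cV[R]_n -> R)) x :> \bar R)%E by rewrite lee_fin.
rewrite -[LHS](lebesgue_cV_scale r0 m1r ge0).
congr (_ * _)%E; apply: eq_integral => x _; congr EFin.
rewrite !indicE; congr (_%:R : R); congr nat_of_bool.
apply/idP/idP; rewrite !inE !eballE// expr1n => H.
  rewrite -(ltr_pM2l (exprn_gt0 2 r0)) mulr1 mulr_sumr; apply: le_lt_trans H.
  by apply: ler_sum => i _; rewrite mxE exprMn.
move: H; rewrite -(ltr_pM2l (exprn_gt0 2 r0)) mulr1 mulr_sumr; apply: le_lt_trans.
by apply: ler_sum => i _; rewrite mxE exprMn.
Qed.

End euclidean_ball.
Arguments measurable_eball {R} n r.

(** * Borel measurability of continuous functions *)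

Section continuous_measurable.
Context {R : realType} {n : nat}.

(** Integer vectors label the cells of the grid of mesh [1 / (k + 1)]: there are countably many of
    them, and each cell is a box. *)
Definition grid_approx (k : nat) (x : 'cV[R]_n) : 'cV[int]_n :=
  \col_i Num.floor (k.+1%:R * x i ord0).

Definition grid_point (k : nat) (z : 'cV[int]_n) : 'cV[R]_n :=
  \col_i ((z i ord0)%:~R / k.+1%:R).

Lemma measurable_grid_cell k z :
  measurable [set x : 'cV[R]_n | grid_approx k x = z].
Proof.
pose I i : set R :=
  `[(z i ord0)%:~R / k.+1%:R, (z i ord0 + 1)%:~R / k.+1%:R[%classic.
rewrite (_ : mkset _ = [set x : 'cV[R]_n | forall i, I i (x i ord0)]).
  by apply: (@measurable_box R n I) => i; exact: measurable_itv.
have cell i (x : 'cV[R]_n) : (x i ord0 \in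
    `[(z i ord0)%:~R / k.+1%:R, (z i ord0 + 1)%:~R / k.+1%:R[) =
    (Num.floor (k.+1%:R * x i ord0) == z i ord0).
  by rewrite floor_eq in_itv/= ler_pdivrMr// ltr_pdivlMr// (mulrC k.+1%:R).
apply/seteqP; split=> [x /= xz i|x /= H].
  by rewrite /I/= cell -xz mxE.
by apply/colP => i; rewrite mxE; apply/eqP; rewrite -cell; exact: H.
Qed.

Lemma grid_point_dist k (x : 'cV[R]_n) i :
  `|x i ord0 - grid_point k (grid_approx k x) i ord0| <= k.+1%:R^-1.
Proof.
rewrite !mxE; set y := k.+1%:R * x i ord0.
have -> : x i ord0 = y / k.+1%:R by rewrite /y mulrAC divff ?mul1r.
rewrite -mulrBl normrM [X in _ * X]gtr0_norm ?invr_gt0//.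
rewrite -[leRHS]mul1r ler_pM2r ?invr_gt0//.
have := floor_le y; have := floorD1_gt y; rewrite intrD => h1 h2.
by rewrite ger0_norm; lra.
Qed.

Lemma cvg_grid (x : 'cV[R]_n) :
  grid_point k (grid_approx k x) @[k --> \oo] --> x.
Proof.
apply/cvg_ballP => e e0; near=> k; split=> // i j; rewrite ord1.
rewrite -ball_normE/=; apply: (le_lt_trans (grid_point_dist _ _ _)).
by near: k; exact: near_infty_natSinv_lt (PosNum e0).
Unshelve. all: by end_near. Qed.

(** The sigma-algebra is generated by the coordinates and not by the open sets, so [f] is written as
    a pointwise limit of functions that are constant on the countably many grid cells. *)
Lemma continuous_measurable_cV (f : 'cV[R]_n -> R) : continuous f ->
  measurable_fun [set: 'cV[R]_n] f.
Proof.
move=> cf; apply: (@measurable_fun_cvg _ _ _ _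
    (fun k x => f (grid_point k (grid_approx k x)))) => [k|x _]; last first.
  by apply: (@cvg_comp _ _ _ _ f); [exact: cvg_grid|exact: cf].
move=> _ Y mY; rewrite setTI.
rewrite (_ : _ @^-1` _ = \bigcup_(z in [set z | Y (f (grid_point k z))])
    [set x : 'cV[R]_n | grid_approx k x = z]).
  rewrite bigcup_mkcond; apply: countable_bigcupT_measurable => // z.
  by case: ifP => // _; exact: measurable_grid_cell.
apply/seteqP; split=> [x /= Yx|x [z /= Yz xz]]; last by rewrite /= xz.
by exists (grid_approx k x).
Qed.

End continuous_measurable.

(** * Test functions and the weak gradient of affine functions *)

Section test_functions.
Context {R : realType} {n : nat}.
Implicit Types (x : 'cV[R]_n) (phi : 'cV[R]_n -> R).

Lemma set_coor_add (j : 'I_n) x t h :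
  set_coor j x (h *: (1 : R) + t) = h *: basis_vec j + set_coor j x t.
Proof.
apply/colP => i; rewrite !mxE eqxx andbT [h%:A]mulr1.
by case: eqP => _; rewrite ?mulr1// mulr0 add0r.
Qed.

Lemma continuous_set_coor (j : 'I_n) x : continuous (set_coor j x).
Proof.
move=> t; apply/cvg_ballP => e e0; near=> s; split=> // i k; rewrite !mxE.
case: eqP => _; last exact: ballxx.
by near: s; exact: (@nbhsx_ballx _ _ t).
Unshelve. all: by end_near. Qed.

Lemma is_derive_set_coor (j : 'I_n) phi x t :
  derivable phi (set_coor j x t) (basis_vec j) ->
  is_derive t (1 : R) (fun s => phi (set_coor j x s))
    (partial j phi (set_coor j x t)).
Proof.
move=> dphi.
have E : (fun h : R => h^-1 *: (((fun s => phi (set_coor j x s)) \o shift t)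
      (h *: (1 : R)) - phi (set_coor j x t))) =
    (fun h => h^-1 *: ((phi \o shift (set_coor j x t)) (h *: basis_vec j)
      - phi (set_coor j x t))).
  by apply/funext => h /=; rewrite set_coor_add.
by apply: DeriveDef; rewrite /derivable /partial /derive E.
Qed.

Lemma smooth_partial (j : 'I_n) phi : smooth phi -> continuous (partial j phi).
Proof. by move=> /(_ [:: j])[]. Qed.

Lemma test_function_out (Omega : set 'cV[R]_n) phi x :
  test_function Omega phi -> ~ Omega x -> phi x = 0.
Proof.
move=> [_ _ sub] Ox; apply/eqP; apply: contrapT => /negP px.
by apply: Ox; apply: sub; exact: subset_closure.
Qed.

Lemma partial_out_tsupport (j : 'I_n) phi x : ~ tsupport phi x -> partial j phi x = 0.
Proof.
move=> tx; rewrite /partial (@near_eq_derive _ _ _ phi (cst 0)) ?derive_cst//.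
have : nbhs x (~` tsupport phi).
  by apply: open_nbhs_nbhs; split=> //; apply: closed_openC; exact: closed_closure.
apply: filterS => y ty; apply/eqP; apply: contrapT => /negP py.
by apply: ty; exact: subset_closure.
Qed.

Lemma bounded_of_compact_support (K : set 'cV[R]_n) (g : 'cV[R]_n -> R) :
  compact K -> continuous g -> (forall x, ~ K x -> g x = 0) ->
  exists C : R, forall x, `|g x| <= C.
Proof.
move=> cK cg g0.
have /compact_bounded[M [_ HM]] : compact (g @` K).
  by apply: continuous_compact => //; exact: continuous_subspaceT.
exists (`|M| + 1) => x; have [Kx|/g0 ->] := pselect (K x); last first.
  by rewrite normr0 addr_ge0.
apply: HM; last by exists x.
by apply: (le_lt_trans (ler_norm _)); rewrite ltrDl.
Qed.

Lemma test_function_bounded (Omega : set 'cV[R]_n) phi :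
  test_function Omega phi -> exists C : R, forall x, `|phi x| <= C.
Proof.
move=> [sphi cphi _]; apply: (bounded_of_compact_support cphi).
  by have [] := sphi [::].
move=> x tx; apply/eqP; apply: contrapT => /negP px.
by apply: tx; exact: subset_closure.
Qed.

Lemma test_function_partial_bounded (Omega : set 'cV[R]_n) (j : 'I_n) phi :
  test_function Omega phi -> exists C : R, forall x, `|partial j phi x| <= C.
Proof.
move=> [sphi cphi _]; apply: (bounded_of_compact_support cphi).
  exact: smooth_partial.
by move=> x; exact: partial_out_tsupport.
Qed.

(** The linear part is a function on indices, so that a row [S i] of a matrix coerces to it. *)
Definition affine (c : R) (w : 'I_n -> R) x : R := c + \sum_k w k * x k ord0.

Lemma measurable_affine c w : measurable_fun [set: 'cV[R]_n] (affine c w).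
Proof.
apply: measurable_funD => //; apply: measurable_sum => k.
by apply: measurable_funM => //; exact: measurable_coor.
Qed.

Lemma affine_bounded c w r : exists C : R, forall x, eball n r x -> `|affine c w x| <= C.
Proof.
exists (`|c| + \sum_k `|w k| * r) => x xB.
apply: (le_trans (ler_normD _ _)); rewrite lerD2l.
apply: (le_trans (ler_norm_sum _ _ _)); apply: ler_sum => k _.
by rewrite normrM ler_wpM2l//; exact: eball_coor.
Qed.

Lemma affine_set_coor c w j x t :
  affine c w (set_coor j x t) = affine c w (set_coor j x 0) + w j * t.
Proof.
rewrite /affine -addrA; congr (_ + _).
rewrite (bigD1 j)//= [in RHS](bigD1 j)//= !mxE eqxx mulr0 add0r addrC.
by congr (_ + _); apply: eq_bigr => k /negPf kj; rewrite !mxE kj.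
Qed.

(** The product rule makes [affine c w * partial j phi + w j * phi] the derivative of
    [affine c w * phi] along each line in direction [j]. That product vanishes far out, so every
    line integral is zero. *)
Lemma weak_partial_affine c w (j : 'I_n) :
  is_weak_partial (eball n (1 : R)) (affine c w) j (fun=> w j).
Proof.
move=> phi tphi; have [sphi cphi sub] := tphi.
set B := eball n 1; have mB : measurable B := measurable_eball n 1.
have [C1 HC1] := test_function_bounded tphi.
have [C2 HC2] := test_function_partial_bounded j tphi.
have [C3 HC3] := @affine_bounded c w 1.
have C10 : 0 <= C1 by exact: le_trans (HC1 0).
have C20 : 0 <= C2 by exact: le_trans (HC2 0).
have cpp : continuous (partial j phi) by exact: smooth_partial.
have cp : continuous phi by have [] := sphi [::].
have dp x : derivable phi x (basis_vec j) by have [_] := sphi [::]; exact.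
have mpp := continuous_measurable_cV cpp.
have mp := continuous_measurable_cV cp.
have ma := @measurable_affine c w.
have m1 : measurable_fun [set: 'cV[R]_n] (fun x => affine c w x * partial j phi x).
  exact: measurable_funM.
have m2 : measurable_fun [set: 'cV[R]_n] (fun x => w j * phi x).
  exact: measurable_funM.
have i1 : (lebesgue_cV n).-integrable B
    (EFin \o (fun x : 'cV[R]_n => affine c w x * partial j phi x)).
  apply: (@integrable_eball _ _ _ _ (C3 * C2)); first exact: measurable_funTS.
  by move=> x xB; rewrite normrM ler_pM//; exact: HC3.
have i2 : (lebesgue_cV n).-integrable B (EFin \o (fun x : 'cV[R]_n => w j * phi x)).
  apply: (@integrable_eball _ _ _ _ (`|w j| * C1)); first exact: measurable_funTS.
  by move=> x xB; rewrite normrM ler_pM.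
apply/eqP; rewrite -addr_eq0 -RintegralD//; apply/eqP.
pose G x := affine c w x * partial j phi x + w j * phi x.
have G0 x : ~ B x -> G x = 0.
  move=> Bx; rewrite /G (test_function_out tphi)// partial_out_tsupport ?mulr0 ?addr0//.
  by move/sub.
rewrite Rintegral_mkcond /Rintegral.
have -> : ((fun x => affine c w x * partial j phi x + w j * phi x) \_ B) = G.
  apply/funext => x; rewrite patchE; case: ifPn => //.
  by rewrite notin_setE => /G0 ->.
rewrite (@integral_lines_eq0 _ _ j G 1 (`|C3| * C2 + `|w j| * C1))//.
- exact: measurable_funD.
- move=> x; have [xB|/G0 ->] := pselect (B x); last first.
    by rewrite normr0 addr_ge0// mulr_ge0.
  apply: (le_trans (ler_normD _ _)); rewrite !normrM lerD// ler_pM//.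
  by apply: (le_trans (HC3 _ xB)); exact: ler_norm.
- by move=> x xc; apply: G0 => xB; apply: xc => i; exact: eball_coor.
- move=> x.
  have dA (t : R) : is_derive t (1 : R) (fun t => affine c w (set_coor j x t)) (w j).
    rewrite (_ : (fun _ => _) =
        (fun t => affine c w (set_coor j x 0) + w j * t)).
      by apply: is_derive_eq; rewrite /GRing.scale/=; ring.
    by apply/funext => s; exact: affine_set_coor.
  have cA : continuous (fun t => affine c w (set_coor j x t)).
    by move=> t; apply/differentiable_continuous/derivable1_diffP; case: (dA t).
  have cS (g : 'cV[R]_n -> R) : continuous g ->
      continuous (fun t => g (set_coor j x t)).
    move=> cg t; apply: (@cvg_comp _ _ _ (set_coor j x) g); last exact: cg.
    exact: continuous_set_coor.
  (* Points of the ball have coordinates bounded by [1], with a non-strict inequality in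
     [eball_coor]; the threshold [2] is safely outside. *)
  apply: (@integral_is_derive_eq0 _
    (fun t => affine c w (set_coor j x t) * phi (set_coor j x t)) _ 2).
  + move=> t; apply: cvgD; apply: cvgM; first exact: cA.
    * exact: (cS _ cpp).
    * exact: cvg_cst.
    * exact: (cS _ cp).
  + move=> t; apply: (is_derive_eq (is_deriveM (dA t) (is_derive_set_coor (dp _)))).
    by rewrite /G /GRing.scale/= (mulrC (phi _)).
  + move=> t t2; have tB : ~ B (set_coor j x t).
      move=> /(@eball_coor _ _ _ _ j); rewrite mxE eqxx => t1.
      by have := le_trans t2 t1; rewrite lern1.
    by split; [rewrite (test_function_out tphi)// mulr0|exact: G0].
Qed.

End test_functions.

(** * Smooth functions of one variable that are flat at the origin *)

Section flat_functions.
Context {R : realType}.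
Implicit Types (p : {poly R}) (t : R).

(** [flat 1] is the classical [exp(-1/t)] extended by [0]; the polynomial factor makes the family
    stable under differentiation. *)
Definition flat p t : R := if 0 < t then p.[t^-1] * expR (- t^-1) else 0.

Lemma expr_expRN_le (s : R) k : 0 <= s -> s ^+ k.+1 * expR (- s) <= k.+1`!%:R.
Proof.
move=> s0; rewrite expRN ler_pdivrMr ?expR_gt0//.
have f0 : 0 < k.+1`!%:R :> R by rewrite ltr0n fact_gt0.
rewrite mulrC -ler_pdivrMr//; apply: le_trans (expR_ge1Dxn k s0).
by rewrite lerDr.
Qed.

(** With [s = 1 / t], the factor [s^i exp(-s)] is [t^2] times the bounded quantity
    [s^(i + 2) exp(-s)]. The quadratic bound makes the difference quotient of [flat p] at [0] tend
    to [0]. *)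
Lemma flat_le_sqr p : exists C : R, forall t, `|flat p t| <= C * t ^+ 2.
Proof.
exists (\sum_(i < size p) `|p`_i| * (i.+2)`!%:R) => t.
rewrite /flat; case: ifPn => [t0|_]; last first.
  by rewrite normr0 mulr_ge0 ?sqr_ge0// sumr_ge0// => i _; rewrite mulr_ge0.
set s := t^-1; have s0 : 0 < s by rewrite invr_gt0.
rewrite normrM (gtr0_norm (expR_gt0 _)) horner_coef.
rewrite mulr_suml; apply: (@le_trans _ _ ((\sum_(i < size p) `|p`_i * s ^+ i|) * expR (- s))).
  by rewrite ler_wpM2r ?expR_ge0// ler_norm_sum.
rewrite mulr_suml; apply: ler_sum => i _.
rewrite normrM -!mulrA ler_wpM2l// (ger0_norm (exprn_ge0 _ (ltW s0))).
have -> : s ^+ i * expR (- s) = s ^+ i.+2 * expR (- s) * t ^+ 2.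
  by rewrite /s !exprS expr0 mulr1; field; rewrite gt_eqF.
by rewrite ler_wpM2r ?sqr_ge0// expr_expRN_le// ltW.
Qed.

(** For [t > 0] the derivative is [(p(1/t) - p'(1/t)) t^-2 exp(-1/t)], whence the polynomial
    [X^2 (p - p')]; for [t <= 0] the derivative is [0], with [flat_le_sqr] settling [t = 0]. *)
Lemma is_derive_flat p t :
  is_derive t (1 : R) (flat p) (flat ('X^2 * (p - p^`())) t).
Proof.
have [t0|t0|<-] := ltgtP 0 t.
- have dF : is_derive t (1 : R) (fun s => p.[s^-1] * expR (- s^-1))
      (flat ('X^2 * (p - p^`())) t).
    have dinv : is_derive t (1 : R) (fun s : R => s^-1) (- t ^- 2).
      have t0' : t != 0 by rewrite gt_eqF.
      apply: (is_derive_eq (is_deriveV t0' (is_derive_id t (1 : R)))).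
      by rewrite [LHS]mulr1.
    have d1 : is_derive t (1 : R) (fun s : R => p.[s^-1]) (p^`().[t^-1] * - t ^- 2).
      exact: (@is_derive1_comp _ (horner p)).
    have d2 : is_derive t (1 : R) (fun s : R => expR (- s^-1))
        (expR (- t^-1) * - (- t ^- 2)).
      apply: (@is_derive1_comp _ expR (fun s => - s^-1)).
    apply: (is_derive_eq (is_deriveM d1 d2)).
    rewrite /flat t0 !hornerE /GRing.scale/= -exprVn; ring.
  have [d1 d2] := dF.
  have E : {near t, flat p =1 (fun s => p.[s^-1] * expR (- s^-1))}.
    by near=> s; rewrite /flat ifT//; near: s; exact: lt_nbhsr.
  apply: DeriveDef; first by apply: near_eq_derivable d1; near=> s; near: s; apply: filterS E => s ->.
  by rewrite -d2; apply: near_eq_derive.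
- have E : {near t, flat p =1 cst 0}.
    near=> s; rewrite /flat ifF//; apply/negbTE; rewrite -leNgt ltW//.
    by near: s; exact: lt_nbhsl.
  have [d1 d2] := is_derive_cst (0 : R) t (1 : R).
  rewrite {2}/flat ltNge (ltW t0)/=.
  apply: DeriveDef; first by apply: near_eq_derivable d1; near=> s; near: s; apply: filterS E => s ->.
  by rewrite -d2; apply: near_eq_derive.
- rewrite {2}/flat ltxx.
  have F0 : flat p 0 = 0 by rewrite /flat ltxx.
  have [C HC] := flat_le_sqr p.
  have L : h^-1 *: ((flat p \o shift 0) (h *: (1 : R)) - flat p 0)
      @[h --> 0^'] --> (0 : R).
    apply/cvgr0Pnorm_lt => e e0; near=> h.
    have h0 : h != 0 by near: h; exact: nbhs_dnbhs_neq.
    rewrite F0 subr0/= addr0 /GRing.scale/= mulr1 normrM normfV.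
    rewrite mulrC ltr_pdivrMr ?normr_gt0//.
    apply: (le_lt_trans (HC h)).
    rewrite -real_normK ?num_real// expr2 mulrA ltr_pM2r ?normr_gt0//.
    apply: (@le_lt_trans _ _ ((`|C| + 1) * `|h|)).
      by rewrite ler_wpM2r// (le_trans (ler_norm _))// lerDl.
    rewrite mulrC -ltr_pdivlMr ?ltr_pwDr//.
    near: h. apply: dnbhs0_lt. by rewrite divr_gt0// ltr_pwDr.
  apply: DeriveDef; first exact: (cvgP _ L).
  exact: (cvg_lim _ L).
Unshelve. all: by end_near. Qed.

Lemma continuous_flat p : continuous (flat p).
Proof.
move=> t; apply/differentiable_continuous/derivable1_diffP.
by case: (is_derive_flat p t).
Qed.

Lemma flat1_ge0 t : 0 <= flat 1 t.
Proof. by rewrite /flat; case: ifP => // _; rewrite hornerE mul1r expR_ge0. Qed.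

Lemma flat1_le1 t : flat 1 t <= 1.
Proof.
rewrite /flat; case: ifP => // t0; rewrite hornerE mul1r -expR0 ler_expR.
by rewrite oppr_le0 invr_ge0 ltW.
Qed.

Lemma flat1_neq0 t : (flat 1 t != 0) = (0 < t).
Proof.
rewrite /flat; case: ifP => _; last by rewrite eqxx.
by rewrite hornerE mul1r gt_eqF ?expR_gt0.
Qed.

Lemma cvg_flat1 (a b : R) : 0 < a -> flat 1 (a * k%:R + b) @[k --> \oo] --> (1 : R).
Proof.
move=> a0.
have E : \forall k \near \oo, expR (- (a * k%:R + b)^-1) = flat 1 (a * k%:R + b).
  near=> k; rewrite /flat hornerE mul1r ifT//.
  rewrite -ltrBlDr sub0r -ltr_pdivrMl//.
  by near: k; exact: nbhs_infty_gtr.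
apply: cvg_trans (near_eq_cvg E) _.
suff L : (- (a * k%:R + b)^-1) @[k --> \oo] --> (0 : R).
  by have := continuous_cvg _ (@continuous_expR R 0) L; rewrite expR0; exact.
rewrite -oppr0; apply: cvgN.
apply/(gtr0_cvgV0 (f := fun k => a * k%:R + b)).
  near=> k; rewrite -ltrBlDr sub0r -ltr_pdivrMl//.
  by near: k; exact: nbhs_infty_gtr.
apply/cvgryPge => A; near=> k.
rewrite -lerBlDr -ler_pdivrMl//.
by near: k; exact: nbhs_infty_ger.
Unshelve. all: by end_near. Qed.

End flat_functions.

(** * Smooth bumps that approximate orthants inside the ball *)

Section tame_functions.
Context {R : realType} {n : nat}.
Implicit Types (f g : 'cV[R]_n -> R) (x : 'cV[R]_n).

(* A class of functions that is visibly closed under partial derivatives. *)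
Inductive tame : ('cV[R]_n -> R) -> Prop :=
| tame_cst c : tame (cst c)
| tame_coor i : tame (fun x => x i ord0)
| tameD f g : tame f -> tame g -> tame (f \+ g)
| tameM f g : tame f -> tame g -> tame (f \* g)
| tame_flat p f : tame f -> tame (flat p \o f).

Lemma tame_sum (I : Type) (s : seq I) (f : I -> 'cV[R]_n -> R) :
  (forall i, tame (f i)) -> tame (fun x => \sum_(i <- s) f i x).
Proof.
move=> tf; elim: s => [|i s IH].
  rewrite (_ : (fun _ => _) = cst 0); first exact: tame_cst.
  by apply/funext => x; rewrite big_nil.
rewrite (_ : (fun _ => _) = f i \+ (fun x => \sum_(i <- s) f i x)).
  exact: tameD.
by apply/funext => x; rewrite big_cons.
Qed.

Lemma tame_prod (I : Type) (s : seq I) (f : I -> 'cV[R]_n -> R) :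
  (forall i, tame (f i)) -> tame (fun x => \prod_(i <- s) f i x).
Proof.
move=> tf; elim: s => [|i s IH].
  rewrite (_ : (fun _ => _) = cst 1); first exact: tame_cst.
  by apply/funext => x; rewrite big_nil.
rewrite (_ : (fun _ => _) = f i \* (fun x => \prod_(i <- s) f i x)).
  exact: tameM.
by apply/funext => x; rewrite big_cons.
Qed.

Lemma tame_continuous f : tame f -> continuous f.
Proof.
elim=> {f} [c|i|f g _ cf _ cg|f g _ cf _ cg|p f _ cf] x.
- exact: cst_continuous.
- exact: coord_continuous.
- exact: continuousD (cf x) (cg x).
- exact: continuousM (cf x) (cg x).
- by apply: (@continuous_comp _ _ _ f (flat p)); [exact: cf|exact: continuous_flat].
Qed.

(** Passing to one real variable allows the one-dimensional chain rule to be applied to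
    [flat p \o f]. *)
Lemma is_derive_along f x (v : 'cV[R]_n) (d : R) :
  is_derive x v f d <-> is_derive (0 : R) (1 : R) (fun t => f (t *: v + x)) d.
Proof.
have E : (fun h : R => h^-1 *: (((fun t => f (t *: v + x)) \o shift 0)
      (h *: (1 : R)) - f (0 *: v + x))) =
    (fun h => h^-1 *: ((f \o shift x) (h *: v) - f x)).
  by apply/funext => h /=; rewrite scale0r add0r addr0 [h%:A]mulr1.
by split=> -[d1 d2]; apply: DeriveDef; move: d1 d2; rewrite /derivable /derive E.
Qed.

Lemma tame_partial (j : 'I_n) f : tame f ->
  exists2 g, tame g & forall x, is_derive x (basis_vec j) f (g x).
Proof.
elim=> {f} [c|i|f g tf [f' tf' df] tg [g' tg' dg]|f g tf [f' tf' df] tg [g' tg' dg]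
  |p f tf [f' tf' df]].
- by exists (cst 0) => [|x]; [exact: tame_cst|exact: is_derive_cst].
- exists (cst (basis_vec j i ord0)) => [|x]; first exact: tame_cst.
  apply/is_derive_along.
  rewrite (_ : (fun _ => _) = (fun t => t * basis_vec j i ord0 + x i ord0)).
    by apply: is_derive_eq; rewrite /GRing.scale/=; ring.
  by apply/funext => t; rewrite !mxE.
- by exists (f' \+ g') => [|x]; [exact: tameD|exact: is_deriveD].
- exists (f \* g' \+ g \* f') => [|x]; last exact: is_deriveM.
  by apply: tameD; apply: tameM.
- exists ((flat ('X^2 * (p - p^`())) \o f) \* f') => [|x].
    by apply: tameM => //; exact: tame_flat.
  apply/is_derive_along; apply: (@is_derive1_comp _ (flat p) (fun t => f (t *: _ + x))).
    by rewrite scale0r add0r; exact: is_derive_flat.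
  by apply/is_derive_along; exact: df.
Qed.

Lemma tame_smooth f : tame f -> smooth f.
Proof.
move=> tf s /=; have {tf} tf : tame (foldr partial f s).
  elim: s => //= j s /(tame_partial j)[g tg dg].
  rewrite (_ : partial j _ = g)//.
  by apply/funext => x; case: (dg x).
split=> [|j x]; first exact: tame_continuous.
by have [g _ /(_ x)[]] := tame_partial j tf.
Qed.

Lemma compact_cube (M : R) : compact (cube n M).
Proof.
have cB : compact [set v : 'rV[R]_n | forall i, `[- M, M]%classic (v ord0 i)].
  exact: (rV_compact (fun i : 'I_n => @segment_compact R (- M) M)).
have ct : continuous (fun v : 'rV[R]_n => v^T : 'cV[R]_n).
  move=> v A [P vP PA]; exists (fun i j => P j i) => [i j|w wP].
    by have := vP j i; rewrite mxE.
  by apply: PA => i j; rewrite mxE; exact: wP.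
have := continuous_compact (continuous_subspaceT ct) cB.
rewrite (_ : image _ _ = cube n M)//; apply/seteqP; split=> [_ [v vM <-] i|x xM].
  by rewrite mxE; have := vM i; rewrite /= in_itv/= ler_norml.
exists x^T; last exact: trmxK.
by move=> i; rewrite mxE /= in_itv/= -ler_norml.
Qed.

(** The shift by [-1] makes the first factor vanish unless [|x|^2 < 1 - 1/k], which keeps the closed
    support inside the open ball. At a point of the ball with all [a i < x_i] every argument tends
    to infinity with [k], where [flat 1] tends to [1]. *)
Definition ball_orthant_bump (a : 'I_n -> R) (k : nat) x : R :=
  flat 1 ((1 - \sum_i x i ord0 ^+ 2) * k%:R - 1) *
  \prod_i flat 1 ((x i ord0 - a i) * k%:R).

Lemma ball_orthant_bump_tame a k : tame (ball_orthant_bump a k).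
Proof.
apply: tameM.
  apply: (@tame_flat 1 (fun x => (1 - \sum_i x i ord0 ^+ 2) * k%:R - 1)).
  apply: (@tameD (fun x => (1 - \sum_i x i ord0 ^+ 2) * k%:R) (cst (-1))); last exact: tame_cst.
  apply: (@tameM (fun x => 1 - \sum_i x i ord0 ^+ 2) (cst k%:R)); last exact: tame_cst.
  rewrite (_ : (fun _ => _) = (cst 1 \+ (cst (-1) \* (fun x => \sum_i x i ord0 ^+ 2)))).
    apply: tameD; first exact: tame_cst.
    apply: tameM; first exact: tame_cst.
    apply: tame_sum => i.
    by apply: (@tameM (fun x => x i ord0) (fun x => x i ord0)); exact: tame_coor.
  by apply/funext => x /=; rewrite mulN1r.
apply: tame_prod => i; apply: (@tame_flat 1 (fun x => (x i ord0 - a i) * k%:R)).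
apply: (@tameM (fun x => x i ord0 - a i) (cst k%:R)); last exact: tame_cst.
apply: (@tameD (fun x => x i ord0) (cst (- a i))); [exact: tame_coor|exact: tame_cst].
Qed.

Lemma ball_orthant_bump_test a k : (0 < k)%N ->
  test_function (eball n 1) (ball_orthant_bump a k).
Proof.
move=> k0.
pose S := (fun x : 'cV[R]_n => \sum_i x i ord0 ^+ 2) @^-1` [set t : R | t <= 1 - k%:R^-1].
have k0' : 0 < k%:R :> R by rewrite ltr0n.
have cS : closed S.
  apply: closed_comp => [x _|]; last exact: closed_le.
  apply: tame_continuous; apply: tame_sum => i.
  by apply: (@tameM (fun x => x i ord0) (fun x => x i ord0)); exact: tame_coor.
have SB : S `<=` eball n 1.
  move=> x; rewrite /S/= => xS; rewrite eballE// expr1n (le_lt_trans xS)//.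
  by rewrite ltrBlDr ltrDl invr_gt0.
have sub : tsupport (ball_orthant_bump a k) `<=` S.
  rewrite /tsupport [X in _ `<=` X](_ : S = closure S); last exact/closure_id.
  apply: closureS => x /=; rewrite /ball_orthant_bump mulf_eq0 negb_or => /andP[+ _].
  rewrite flat1_neq0 /S/= subr_gt0 -ltr_pdivrMr// mul1r; lra.
split.
- exact/tame_smooth/ball_orthant_bump_tame.
- apply: (subclosed_compact _ (@compact_cube 1)); first exact: closed_closure.
  by move=> x /sub /SB xB i; exact: eball_coor.
- exact: subset_trans SB.
Qed.

Lemma ball_orthant_bump_ge0 a k x : 0 <= ball_orthant_bump a k x.
Proof.
by rewrite mulr_ge0 ?flat1_ge0// prodr_ge0// => i _; exact: flat1_ge0.
Qed.

Lemma ball_orthant_bump_le1 a k x : ball_orthant_bump a k x <= 1.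
Proof.
rewrite mulr_ile1 ?flat1_ge0 ?flat1_le1//.
  by rewrite prodr_ge0// => i _; exact: flat1_ge0.
by rewrite prodr_ile1// => i _; rewrite flat1_ge0 flat1_le1.
Qed.

Definition orthant (a : 'I_n -> R) : set 'cV[R]_n := [set x | forall i, a i < x i ord0].

Lemma cvg_ball_orthant_bump a x : eball n 1 x ->
  ball_orthant_bump a k x @[k --> \oo] --> (\1_(orthant a) x : R).
Proof.
rewrite eballE// expr1n => xB; rewrite indicE.
have [xO|xO] := pselect (orthant a x).
  rewrite mem_set//= -[X in _ --> X]mulr1; apply: cvgM.
    by apply: cvg_flat1; rewrite subr_gt0.
  elim: (index_enum _) => [|i s IH].
    by under eq_fun do rewrite big_nil; exact: cvg_cst.
  under eq_fun do rewrite big_cons.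
  have L : flat 1 ((x i ord0 - a i) * k%:R) @[k --> \oo] --> (1 : R).
    have := @cvg_flat1 R (x i ord0 - a i) 0.
    by under eq_fun do rewrite addr0; apply; rewrite subr_gt0; exact: xO.
  by have := cvgM L IH; rewrite mulr1; exact.
rewrite memNset//=.
have [i xi] : exists i, ~ a i < x i ord0 by apply/existsNP.
rewrite (_ : (fun _ => _) = cst 0); first exact: cvg_cst.
apply/funext => k; rewrite /ball_orthant_bump [X in _ * X](bigD1 i)//=.
have -> : flat 1 ((x i ord0 - a i) * k%:R) = 0.
  apply/eqP; rewrite -[_ == _]negbK flat1_neq0 -leNgt mulr_le0_ge0// subr_le0 leNgt.
  exact/negP.
by rewrite mul0r mulr0.
Qed.

End tame_functions.

(** * The fundamental lemma of the calculus of variations on the unit ball *)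

Section fundamental_lemma.
Context {R : realType} {n : nat}.
Notation mu := (@lebesgue_cV R n).
Notation B := (eball n (1 : R)).
Implicit Types (f g : 'cV[R]_n -> R).

Definition orthants : set (set 'cV[R]_n) := [set A | exists a, A = orthant a].

Lemma measurable_orthant (a : 'I_n -> R) : measurable (orthant a : set 'cV[R]_n).
Proof.
rewrite (_ : orthant a =
    [set x : 'cV[R]_n | forall i, `]a i, +oo[%classic (x i ord0)]).
  by apply: (@measurable_box R n (fun i => `]a i, +oo[%classic)) => i; exact: measurable_itv.
by apply/seteqP; split=> x /= H i; have := H i; rewrite /= in_itv/= andbT.
Qed.

(** The half-space [t < x_i] is the union over [m] of the orthants with corner [t] in coordinate [i]
    and [-m] elsewhere, and the rays []t, +oo[] generate the Borel sets of the line. *)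
Lemma measurable_cV_orthants :
  @measurable _ 'cV[R]_n = <<s orthants >>.
Proof.
apply/seteqP; split; last first.
  apply: smallest_sub; first exact: sigma_algebra_measurable.
  by move=> _ [a ->]; exact: measurable_orthant.
apply: smallest_sub; first exact: smallest_sigma_algebra.
move=> A; rewrite -bigcup_seq/= => -[i _ [Y mY <-]]; rewrite setTI.
have {mY} : (RGenOInfty.G (R := R)).-sigma.-measurable Y by rewrite -RGenOInfty.measurableE.
apply: (@smallest_sub _ (sigma_algebra setT) (RGenOInfty.G (R := R))
  [set Y | <<s orthants >> ((fun x : 'cV[R]_n => x i ord0) @^-1` Y)]).
  split=> /=.
  - by rewrite preimage_set0; exact: sigma_algebra0.
  - by move=> C HC; rewrite setTD preimage_setC; exact: sigma_algebraC.
  - by move=> F HF; rewrite preimage_bigcup; exact: sigma_algebra_bigcup.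
move=> _ [t ->] /=.
rewrite (_ : _ @^-1` _ = \bigcup_m
    (orthant (fun k => if k == i then t else - m%:R) : set 'cV[R]_n)).
  apply: sigma_algebra_bigcup => m; apply: sub_sigma_algebra.
  by exists (fun k => if k == i then t else - m%:R).
apply/seteqP; split=> [x /=|x [m _ /(_ i)]]; last by rewrite eqxx /= in_itv/= andbT.
rewrite in_itv/= andbT => tx; exists (Num.truncn `|x|).+1 => // k.
case: eqP => [->//|_]; rewrite ltrNl.
apply: le_lt_trans (truncnS_gt _).
apply: (@le_trans _ _ `|x k ord0|); first by rewrite -normrN ler_norm.
rewrite [leRHS]/Num.norm/= mx_normrE.
exact: (@le_bigmax _ _ _ _ (fun ij => `|x ij.1 ij.2|) (k, ord0)).
Qed.

Lemma setI_closed_orthants : setI_closed orthants.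
Proof.
move=> _ _ [a ->] [b ->]; exists (fun i => Num.max (a i) (b i)).
apply/seteqP; split=> [x [xa xb] i|x xab]; first by rewrite gt_max xa xb.
by split=> i; have := xab i; rewrite gt_max => /andP[].
Qed.

Lemma fundamental_lemma g : mu.-integrable B (EFin \o g) ->
  (forall phi, test_function B phi -> \int[mu]_(x in B) (g x * phi x) = 0) ->
  ae_eq mu B g (cst 0).
Proof.
move=> ig Hg; have mB := measurable_eball n (1 : R).
have mg : measurable_fun B g by apply/measurable_EFinP; exact: measurable_int ig.
have igS A : measurable A -> mu.-integrable (A `&` B) (EFin \o g).
  by move=> mA; apply: integrableS ig => //; exact: measurableI.
pose P (A : set 'cV[R]_n) := (\int[mu]_(x in A `&` B) (g x)%:E = 0)%E.
have PG a : P (orthant a).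
  have mO := measurable_orthant a.
  (* The index [k.+1] meets the hypothesis [0 < k] of [ball_orthant_bump_test]. *)
  pose f_ k x := (g x * ball_orthant_bump a k.+1 x)%:E.
  pose f x := (g x * \1_(orthant a) x)%:E.
  have mf_ k : measurable_fun B (f_ k).
    apply/measurable_EFinP; apply: measurable_funM => //; apply: measurable_funTS.
    apply: continuous_measurable_cV; apply: tame_continuous.
    exact: ball_orthant_bump_tame.
  have mf : measurable_fun B f.
    apply/measurable_EFinP; apply: measurable_funM => //; apply: measurable_funTS.
  (* The bumps take values in [[0, 1]], so [|g|] dominates. *)
  have [||_ _] := dominated_convergence mB mf_ mf _ (integrable_abse ig).
  - apply: aeW => x xB; apply/fine_cvgP; split; first by apply: nearW.
    apply: cvgM; first exact: cvg_cst.
    have := cvg_ball_orthant_bump (a := a) xB.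
    by rewrite -(cvg_shiftS (fun k => ball_orthant_bump a k x)).
  - apply: aeW => x k xB; rewrite /f_ /= lee_fin normrM ler_piMr//.
    by rewrite ger0_norm ?ball_orthant_bump_ge0 ?ball_orthant_bump_le1.
  have -> : [sequence \int[mu]_(x in B) f_ k x]_k%E = cst 0%E.
    apply/funext => k /=.
    have := Hg _ (ball_orthant_bump_test a (ltn0Sn k)).
    (* [Hg] speaks of the real-valued integral, and [fine] also sends the infinities to [0];
       integrability of the product excludes them. *)
    rewrite /Rintegral => /eqP; rewrite fine_eq0 => [/eqP //|].
    apply: integrable_fin_num => //.
    apply: (le_integrable mB (mf_ k) _ ig) => x xB; rewrite lee_fin /= normrM ler_piMr//.
    by rewrite ger0_norm ?ball_orthant_bump_ge0 ?ball_orthant_bump_le1.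
  move=> /cvg_lim; rewrite lim_cst// => /(_ (@ereal_hausdorff R)) E.
  rewrite /P setIC integral_mkcondr [RHS]E; apply: eq_integral => x _.
  by rewrite patchE /f indicE; case: ifP => _; rewrite ?mulr1 ?mulr0.
(* The orthant with corner [-2] in every coordinate contains the ball. The value on the whole space
   is needed for complements. *)
have PT : P setT.
  have := PG (fun=> -2); rewrite /P setTI setIidr// => x xB i.
  by have := eball_coor i xB; rewrite ler_norml => /andP[+ _]; apply: lt_le_trans; lra.
have Pall A : measurable A -> P A.
  rewrite measurable_cV_orthants; apply: (dynkin_induction measurable_cV_orthants) => //.
  - exact: setI_closed_orthants.
  - by move=> _ [a ->]; exact: PG.
  - move=> S mS PS; rewrite /P.
    have mC := measurableC mS.
    have := PT; rewrite /P -(setvU S) setIUl integral_setU.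
    + by rewrite PS adde0.
    + exact: measurableI.
    + exact: measurableI.
    + by rewrite -setIUl setvU setTI; exact/measurable_EFinP.
    + by apply/disj_set2P; rewrite setIACA setICl set0I.
  - move=> F mF tF PF; rewrite /P setI_bigcupl integral_bigcup.
    + by apply: eseries0 => k _ _; exact: PF.
    + exact: trivIset_setIr.
    + by move=> k; exact: measurableI.
    + by rewrite -setI_bigcupl; apply: igS; exact: bigcupT_measurable.
have : ae_eq mu B (EFin \o g) (cst 0%E).
  apply: integral_ae_eq => // E EB mE.
  by rewrite integral0; have := Pall E mE; rewrite /P (setIidl EB).
by apply: filterS => x H xB; have := H xB => -[].
Qed.

End fundamental_lemma.

(** * Square-integrable functions and their averages *)

Section square_integrable.
Context {R : realType} {n : nat}.
Notation mu := (@lebesgue_cV R n).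
Implicit Types (D : set 'cV[R]_n) (f g : 'cV[R]_n -> R).

Lemma ae_eq_Rintegral D f g : measurable D -> measurable_fun D f ->
  measurable_fun D g -> ae_eq mu D f g ->
  \int[mu]_(x in D) f x = \int[mu]_(x in D) g x.
Proof.
move=> mD mf mg fg; congr fine; apply: ae_eq_integral => //.
- exact/measurable_EFinP.
- exact/measurable_EFinP.
- by apply: filterS fg => x H /H /= ->.
Qed.

Lemma L2_integrable_sqr D f : measurable D -> L2 D f ->
  mu.-integrable D (EFin \o (fun x => f x ^+ 2)).
Proof.
move=> mD [mf fi]; apply/integrableP; split.
  by apply/measurable_EFinP; exact: measurable_funX.
apply: le_lt_trans fi; rewrite le_eqVlt; apply/orP; left; apply/eqP.
by apply: eq_integral => x _ /=; rewrite ger0_norm// sqr_ge0.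
Qed.

Lemma L2_integrable_dom D f g : measurable D -> measurable_fun D g ->
  (forall x, D x -> `|g x ^+ 2| <= `|f x|) ->
  mu.-integrable D (EFin \o f) -> L2 D g.
Proof.
move=> mD mg gf fi; split=> //.
have /integrableP[_] := @le_integrable _ _ _ mu D mD (EFin \o (fun x => g x ^+ 2))
  (EFin \o f) ltac:(by apply/measurable_EFinP; exact: measurable_funX) gf fi.
apply: le_lt_trans; rewrite le_eqVlt; apply/orP; left; apply/eqP.
by apply: eq_integral => x _ /=; rewrite ger0_norm// sqr_ge0.
Qed.

Lemma L2_integrableM D f g : measurable D -> L2 D f -> L2 D g ->
  mu.-integrable D (EFin \o (fun x => f x * g x)).
Proof.
move=> mD Lf Lg.
have := integrableD mD (L2_integrable_sqr mD Lf) (L2_integrable_sqr mD Lg).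
apply: le_integrable => //.
  by apply/measurable_EFinP; apply: measurable_funM; [case: Lf|case: Lg].
move=> x _ /=; rewrite lee_fin [leRHS]ger0_norm ?addr_ge0 ?sqr_ge0//.
have := sqr_ge0 (f x - g x); have := sqr_ge0 (f x + g x).
have := sqr_ge0 (f x); have := sqr_ge0 (g x).
by rewrite ler_norml => *; apply/andP; split; nra.
Qed.

Lemma L2_cst D c : measurable D -> (mu D < +oo)%E -> L2 D (cst c).
Proof.
move=> mD Doo; split; first exact: measurable_cst.
have /= -> := integral_cst mu mD (c ^+ 2)%:E; rewrite lte_mul_pinfty ?lee_fin ?sqr_ge0//.
Qed.

Lemma L2_integrable D f : measurable D -> (mu D < +oo)%E -> L2 D f ->
  mu.-integrable D (EFin \o f).
Proof.
move=> mD Doo Lf; have := L2_integrableM mD Lf (L2_cst 1 mD Doo).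
by apply: eq_integrable => // x _ /=; rewrite mulr1.
Qed.

Lemma L2D D f g : measurable D -> L2 D f -> L2 D g -> L2 D (fun x => f x + g x).
Proof.
move=> mD Lf Lg.
have H := integrableD mD (L2_integrable_sqr mD Lf) (L2_integrable_sqr mD Lg).
have := integrableZl mD 2 H; apply: L2_integrable_dom => //.
  by apply: measurable_funD; [case: Lf|case: Lg].
move=> x _ /=; have f0 := sqr_ge0 (f x); have g0 := sqr_ge0 (g x).
rewrite [leRHS]ger0_norm; last by rewrite mulr_ge0// addr_ge0.
by rewrite ger0_norm ?sqr_ge0//; have := sqr_ge0 (f x - g x); nra.
Qed.

Lemma L2Z D f c : measurable D -> L2 D f -> L2 D (fun x => c * f x).
Proof.
move=> mD Lf.
have := integrableZl mD (c ^+ 2) (L2_integrable_sqr mD Lf).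
apply: L2_integrable_dom => //.
  by apply: measurable_funM => //; case: Lf.
by move=> x _ /=; rewrite exprMn.
Qed.

Lemma L2B D f g : measurable D -> L2 D f -> L2 D g -> L2 D (fun x => f x - g x).
Proof.
move=> mD Lf Lg; have := L2D mD Lf (L2Z (-1) mD Lg).
by under eq_fun do rewrite mulN1r.
Qed.

Lemma L2S D E f : measurable D -> measurable E -> E `<=` D -> L2 D f -> L2 E f.
Proof.
move=> mD mE ED Lf; have := L2_integrable_sqr mD Lf.
move=> /(integrableS mD mE ED); apply: L2_integrable_dom => //.
by case: Lf => + _; exact: measurable_funS.
Qed.

Lemma L2_bounded D f (C : R) : measurable D -> (mu D < +oo)%E ->
  measurable_fun D f -> (forall x, D x -> `|f x| <= C) -> L2 D f.
Proof.
move=> mD Doo mf fC.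
have := L2_integrable_sqr mD (L2_cst C mD Doo).
apply: L2_integrable_dom => // x xD /=; rewrite !normrX ler_pXn2r ?nnegrE//.
by rewrite (le_trans (fC _ xD))// ler_norm.
Qed.

(** The squared norm instead of [L2norm]: it adds up over components, and square roots are taken
    only at the end. *)
Definition sqint D f : R := \int[mu]_(x in D) (f x ^+ 2).

Lemma sqint_ge0 D f : 0 <= sqint D f.
Proof. by apply: Rintegral_ge0 => x _; exact: sqr_ge0. Qed.

Lemma sqintS D E f : measurable D -> measurable E -> E `<=` D -> L2 D f ->
  sqint E f <= sqint D f.
Proof.
move=> mD mE ED Lf; have fi := L2_integrable_sqr mD Lf.
rewrite /sqint /Rintegral fine_le//.
- by apply: integrable_fin_num => //; exact: (integrableS mD mE ED).
- exact: integrable_fin_num.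
- apply: ge0_subset_integral => //; first by case/integrableP: fi.
  by move=> x _; rewrite lee_fin sqr_ge0.
Qed.

(* AM-GM: [2 |f g| <= s f^2 + s^-1 g^2] *)
Lemma sqintB_le D f g (s : R) : measurable D -> 0 < s -> L2 D f -> L2 D g ->
  sqint D (fun x => f x - g x) <= (1 + s) * sqint D f + (1 + s^-1) * sqint D g.
Proof.
move=> mD s0 Lf Lg.
have fi := L2_integrable_sqr mD Lf; have gi := L2_integrable_sqr mD Lg.
have fi' := integrableZl mD (1 + s) fi; have gi' := integrableZl mD (1 + s^-1) gi.
rewrite /sqint -!RintegralZl// -RintegralD//.
apply: le_Rintegral => //.
- exact: (L2_integrable_sqr mD (L2B mD Lf Lg)).
- exact: (integrableD mD fi' gi').
move=> x _; have ss : s * s^-1 = 1 by rewrite divff// gt_eqF.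
have t0 : 0 < s^-1 by rewrite invr_gt0.
have := sqr_ge0 (s * f x + g x).
rewrite -(@pmulr_rge0 _ s^-1)// => H.
rewrite -subr_ge0; suff <- : s^-1 * (s * f x + g x) ^+ 2 =
  (1 + s) * f x ^+ 2 + (1 + s^-1) * g x ^+ 2 - (f x - g x) ^+ 2 by [].
by field; rewrite gt_eqF.
Qed.

(** Jensen for the square, by expanding the integral of [(f - m)^2 >= 0]. If [D] is null both sides
    are [0], because [0^-1 = 0]. *)
Lemma avg_sqr_le D f : measurable D -> (mu D < +oo)%E -> L2 D f ->
  avg D f ^+ 2 <= (fine (mu D))^-1 * sqint D f.
Proof.
move=> mD Doo Lf; set V := fine (mu D); set m := avg D f.
have [V0|V0] := eqVneq V 0.
  by rewrite /m /avg -/V V0 invr0 !mul0r expr0n.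
have Vp : 0 < V by rewrite lt_neqAle eq_sym V0 fine_ge0.
have fi := L2_integrable mD Doo Lf; have ffi := L2_integrable_sqr mD Lf.
have Im : \int[mu]_(x in D) f x = V * m by rewrite /m /avg mulrA mulfV// mul1r.
have : 0 <= \int[mu]_(x in D) ((f x ^+ 2 - 2 * m * f x) + m ^+ 2).
  by apply: Rintegral_ge0 => x _; have := sqr_ge0 (f x - m); nra.
have mi : mu.-integrable D (EFin \o (fun=> m ^+ 2)).
  by apply: L2_integrable => //; exact: L2_cst.
have f2i : mu.-integrable D (EFin \o (fun x => 2 * m * f x)).
  exact: (integrableZl mD (2 * m) fi).
rewrite RintegralD//; last exact: (integrableB mD ffi f2i).
rewrite RintegralB// RintegralZl// Rintegral_cst// Im -/V -/(sqint D f).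
rewrite ler_pdivlMl//; nra.
Qed.

Lemma L2norm_mx_sqr p q D (F : 'cV[R]_n -> 'M[R]_(p, q)) : measurable D ->
  (forall i j, L2 D (fun x => F x i j)) ->
  L2norm_mx D F ^+ 2 = \sum_i \sum_j sqint D (fun x => F x i j).
Proof.
move=> mD LF; rewrite /L2norm_mx /L2norm sqr_sqrtr; last first.
  by apply: Rintegral_ge0 => x _; exact: sqr_ge0.
under eq_Rintegral do rewrite fnorm_sqr.
rewrite Rintegral_sum//; last first.
  by move=> i; apply: integrable_EFin_sum => // j; exact: L2_integrable_sqr.
by apply: eq_bigr => i _; rewrite Rintegral_sum// => j; exact: L2_integrable_sqr.
Qed.

End square_integrable.

(** * Weak derivatives on the unit ball and the norms computed from them *)

Section weak_derivatives.
Context {R : realType} {n : nat}.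
Notation mu := (@lebesgue_cV R n).
Notation B := (eball n (1 : R)).
Implicit Types (f g h : 'cV[R]_n -> R).

Let mB : measurable B := measurable_eball n 1.
Let Boo : (mu B < +oo)%E := lebesgue_eball_lty n 1.

Lemma test_function_L2 phi : test_function B phi -> L2 B phi.
Proof.
move=> tphi; have [C HC] := test_function_bounded tphi.
apply: (L2_bounded mB Boo) => [|x _]; last exact: HC.
apply: measurable_funTS; apply: continuous_measurable_cV.
by have [/(_ [::])[]] := tphi.
Qed.

Lemma test_function_partial_L2 (j : 'I_n) phi :
  test_function B phi -> L2 B (partial j phi).
Proof.
move=> tphi; have [C HC] := test_function_partial_bounded j tphi.
apply: (L2_bounded mB Boo) => [|x _]; last exact: HC.
apply: measurable_funTS; apply: continuous_measurable_cV.
by apply: smooth_partial; case: tphi.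
Qed.

Lemma is_weak_partialB f g (j : 'I_n) f' g' : L2 B f -> L2 B g -> L2 B f' -> L2 B g' ->
  is_weak_partial B f j f' -> is_weak_partial B g j g' ->
  is_weak_partial B (fun x => f x - g x) j (fun x => f' x - g' x).
Proof.
move=> Lf Lg Lf' Lg' wf wg phi tphi.
have Lp := test_function_L2 tphi; have Ldp := test_function_partial_L2 j tphi.
under eq_Rintegral do rewrite mulrBl.
rewrite RintegralB//; try exact: L2_integrableM.
under [in RHS]eq_Rintegral do rewrite mulrBl.
rewrite RintegralB//; try exact: L2_integrableM.
by rewrite wf// wg// opprD opprK.
Qed.

Lemma is_weak_partial_unique f (j : 'I_n) g h : L2 B g -> L2 B h ->
  is_weak_partial B f j g -> is_weak_partial B f j h -> ae_eq mu B g h.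
Proof.
move=> Lg Lh wg wh.
have : ae_eq mu B (fun x => g x - h x) (cst 0).
  apply: fundamental_lemma => [|phi tphi].
    by apply: L2_integrable => //; exact: L2B.
  have Lp := test_function_L2 tphi.
  under eq_Rintegral do rewrite mulrBl.
  rewrite RintegralB//; try exact: L2_integrableM.
  apply/eqP; rewrite subr_eq0; apply/eqP/oppr_inj.
  by rewrite -wg// -wh.
by apply: filterS => x H /H /= /eqP; rewrite subr_eq0 => /eqP.
Qed.

(** [xget] returns a weak derivative only when one exists; [g] provides existence, and uniqueness
    then gives equality almost everywhere. *)
Lemma weak_partial_ae f (j : 'I_n) g : L2 B g -> is_weak_partial B f j g ->
  L2 B (weak_partial B f j) /\ ae_eq mu B (weak_partial B f j) g.
Proof.
move=> Lg wg.
have [L w] : [set g | L2 B g /\ is_weak_partial B f j g] (weak_partial B f j).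
  by apply: xgetPex; exists g.
by split=> //; exact: is_weak_partial_unique w wg.
Qed.

Lemma W12_weak_partial f (j : 'I_n) : W12 B f ->
  L2 B (weak_partial B f j) /\ is_weak_partial B f j (weak_partial B f j).
Proof.
by move=> [_ /(_ j)[g Lg wg]]; apply: (@xgetPex _ (cst 0)
  [set g | L2 B g /\ is_weak_partial B f j g]); exists g.
Qed.

Lemma sqint_weak_partial f (j : 'I_n) g : L2 B g -> is_weak_partial B f j g ->
  sqint B (weak_partial B f j) = sqint B g.
Proof.
move=> Lg wg; have [L fg] := weak_partial_ae Lg wg.
apply: ae_eq_Rintegral => //.
- by apply: measurable_funX; case: L.
- by apply: measurable_funX; case: Lg.
- by apply: filterS fg => x H /H ->.
Qed.

Lemma L2norm_grad_sqr f (g : 'I_n -> 'cV[R]_n -> R) : (forall j, L2 B (g j)) ->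
  (forall j, is_weak_partial B f j (g j)) ->
  L2norm_mx B (weak_grad B f) ^+ 2 = \sum_j sqint B (g j).
Proof.
move=> Lg wg.
have E j : (fun x => weak_grad B f x ord0 j) = weak_partial B f j.
  by apply/funext => x; rewrite mxE.
rewrite L2norm_mx_sqr// ?big_ord1; last first.
  by move=> i j; rewrite ord1 E; have [] := weak_partial_ae (Lg j) (wg j).
by apply: eq_bigr => j _; rewrite E (sqint_weak_partial (Lg j) (wg j)).
Qed.

(** Any family [g] of weak derivatives computes the norm, so [T u] and [u - T u] can be measured
    with explicit gradients in place of the chosen representatives. *)
Lemma W12norm_sqr m (u : 'cV[R]_n -> 'cV[R]_m) (g : 'I_m -> 'I_n -> 'cV[R]_n -> R) :
  (forall i, L2 B (fun x => u x i ord0)) -> (forall i j, L2 B (g i j)) ->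
  (forall i j, is_weak_partial B (fun x => u x i ord0) j (g i j)) ->
  W12norm B u ^+ 2 = \sum_i sqint B (fun x => u x i ord0) +
    \sum_i \sum_j sqint B (g i j).
Proof.
move=> Lu Lg wg.
have LD i j := (weak_partial_ae (Lg i j) (wg i j)).1.
rewrite /W12norm sqr_sqrtr; last first.
  by apply: Rintegral_ge0 => x _; rewrite addr_ge0// sqr_ge0.
have E (x : 'cV[R]_n) : fnorm (u x) ^+ 2 + fnorm (weak_gradv B u x) ^+ 2 =
   \sum_i u x i ord0 ^+ 2 +
   \sum_i \sum_j weak_partial B (fun y => u y i ord0) j x ^+ 2.
  rewrite fnorm_col_sqr fnorm_sqr; congr (_ + _).
  by apply: eq_bigr => i _; apply: eq_bigr => j _; rewrite mxE.
under eq_Rintegral do rewrite E.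
have iu i := L2_integrable_sqr mB (Lu i); have iD i j := L2_integrable_sqr mB (LD i j).
have iDs i : mu.-integrable B (EFin \o
    (fun x => \sum_j weak_partial B (fun y => u y i ord0) j x ^+ 2)).
  by apply: integrable_EFin_sum => // j; exact: iD.
rewrite RintegralD//; try by apply: integrable_EFin_sum.
rewrite Rintegral_sum//; congr (_ + _).
rewrite Rintegral_sum//; apply: eq_bigr => i _.
rewrite Rintegral_sum//; apply: eq_bigr => j _.
exact: sqint_weak_partial (Lg i j) (wg i j).
Qed.

Lemma affine_L2 c (w : 'I_n -> R) : L2 B (affine c w).
Proof.
have [C HC] := @affine_bounded R n c w 1.
by apply: (L2_bounded mB Boo) HC; apply: measurable_funTS; exact: measurable_affine.
Qed.

Lemma affine_W12 c (w : 'I_n -> R) : W12 B (affine c w).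
Proof.
split; first exact: affine_L2.
move=> j; exists (fun=> w j); first exact: L2_cst.
exact: weak_partial_affine.
Qed.

Lemma avg_affine r c (w : 'I_n -> R) : 0 < r -> fine (mu (eball n r)) != 0 ->
  avg (eball n r) (affine c w) = c.
Proof.
move=> r0 V0; have mr := measurable_eball n r.
rewrite /avg /affine RintegralD//; last 2 first.
- apply: L2_integrable => //; first exact: lebesgue_eball_lty.
  by apply: L2_cst => //; exact: lebesgue_eball_lty.
- apply: integrable_EFin_sum => // k.
  exact: (integrableZl mr (w k) (integrable_eball_coor r k)).
rewrite Rintegral_cst// Rintegral_sum//; last first.
  by move=> k; exact: (integrableZl mr (w k) (integrable_eball_coor r k)).
rewrite big1 => [|k _]; first by rewrite addr0 mulrCA mulVf// mulr1.
rewrite RintegralZl//; last exact: integrable_eball_coor.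
by rewrite Rintegral_eball_coor// mulr0.
Qed.

Lemma sqint_affine c (w : 'I_n -> R) :
  sqint B (affine c w) =
  fine (mu B) * (c ^+ 2 + (\sum_k w k ^+ 2) / (n%:R + 2)).
Proof.
have ic : mu.-integrable B (EFin \o (fun=> c ^+ 2)).
  by apply: L2_integrable => //; exact: L2_cst.
have i1 k : mu.-integrable B (EFin \o (fun x : 'cV[R]_n => 2 * c * w k * x k ord0)).
  exact: (integrableZl mB _ (integrable_eball_coor 1 k)).
have i2 k l : mu.-integrable B
    (EFin \o (fun x : 'cV[R]_n => w k * w l * (x k ord0 * x l ord0))).
  exact: (integrableZl mB _ (integrable_eball_coorM 1 k l)).
have i2s k : mu.-integrable B
    (EFin \o (fun x : 'cV[R]_n => \sum_l w k * w l * (x k ord0 * x l ord0))).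
  by apply: integrable_EFin_sum => // l; exact: i2.
have E (x : 'cV[R]_n) : affine c w x ^+ 2 = c ^+ 2 +
    (\sum_k 2 * c * w k * x k ord0 + \sum_k \sum_l w k * w l * (x k ord0 * x l ord0)).
  rewrite /affine sqrrD -addrA; congr (_ + (_ + _)).
    by rewrite -mulr_natl mulr_sumr mulr_sumr; apply: eq_bigr => k _; ring.
  rewrite expr2 mulr_suml; apply: eq_bigr => k _; rewrite mulr_sumr.
  by apply: eq_bigr => l _; ring.
rewrite /sqint; under eq_Rintegral do rewrite E.
have iA := integrable_EFin_sum mB (index_enum _) i1.
have iB := integrable_EFin_sum mB (index_enum _) i2s.
rewrite RintegralD//; last exact: (integrableD mB iA iB).
rewrite RintegralD//.
rewrite Rintegral_cst// !Rintegral_sum//.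
rewrite [X in _ + (X + _)]big1 => [|k _]; last first.
  by rewrite RintegralZl ?Rintegral_eball_coor ?mulr0//; exact: integrable_eball_coor.
rewrite add0r mulrDr mulrC; congr (_ + _).
rewrite mulr_suml mulr_sumr; apply: eq_bigr => k _.
rewrite Rintegral_sum// (bigD1 k)//= big1 => [|l lk]; last first.
  rewrite RintegralZl ?Rintegral_eball_coorM ?mulr0// 1?eq_sym//.
  exact: integrable_eball_coorM.
rewrite RintegralZl//; last exact: integrable_eball_coorM.
have -> := Rintegral_eball_coor_sqr k (@ltr01 R).
by rewrite expr1n mul1r addr0 expr2; ring.
Qed.

End weak_derivatives.


(** * The bound on the operator norm *)

Section rigid_projection.
Context {R : realType} {n : nat}.
Notation mu := (@lebesgue_cV R n).
Notation B := (eball n (1 : R)).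
Implicit Types (u : 'cV[R]_n -> 'cV[R]_n).

Let mB : measurable B := measurable_eball n 1.
Let Boo : (mu B < +oo)%E := lebesgue_eball_lty n 1.

Lemma center_of_mass_eball r : 0 < r -> center_of_mass (eball n r) = 0 :> 'cV[R]_n.
Proof.
move=> r0; apply/colP => i; rewrite !mxE /avg.
by rewrite Rintegral_eball_coor// mulr0.
Qed.

Lemma avg_skew_gradE F u i j : avg_skew_grad B F u i j =
  2^-1 * avg F (fun x => weak_partial B (fun y => u y i ord0) j x -
                         weak_partial B (fun y => u y j ord0) i x).
Proof.
rewrite !mxE; congr (_ * avg F _); apply/funext => x; by rewrite !mxE.
Qed.

(** Antisymmetry is what makes [P u] a rigid motion, hence fixed by [T]; it supplies the hypothesis
    [t = - s] of [avg_skew_sub]. *)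
Lemma avg_skew_grad_antisym u i j : W12v B u ->
  avg_skew_grad B B u j i = - avg_skew_grad B B u i j.
Proof.
move=> Wu; rewrite !avg_skew_gradE -mulrN /avg -mulrN; congr (_ * (_ * _)).
have LD k l := L2_integrable mB Boo (W12_weak_partial l (Wu k)).1.
have swap f g : mu.-integrable B (EFin \o f) -> mu.-integrable B (EFin \o g) ->
    \int[mu]_(x in B) (g x - f x) = - \int[mu]_(x in B) (f x - g x).
  by move=> fi gi; rewrite RintegralB// RintegralB// opprB.
exact: (swap _ _ (LD i j) (LD j i)).
Qed.

Lemma rigid_projE r u x i : 0 < r -> rigid_proj B (eball n r) u x i ord0 =
  affine (avg (eball n r) (fun y => u y i ord0))
    (avg_skew_grad B (eball n r) u i) x.
Proof.
by move=> r0; rewrite /rigid_proj center_of_mass_eball// subr0 !mxE.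
Qed.

(** Stated for arbitrary [f] and [g] because it serves twice: for [u] and its gradient in the
    operator norm, and for [v = u - P u] and its gradient in the error estimate. *)
Lemma sum_sqint_rigid_le (rho : R) (f : 'I_n -> 'cV[R]_n -> R)
    (g : 'I_n -> 'I_n -> 'cV[R]_n -> R) (c : 'I_n -> R) (S : 'I_n -> 'I_n -> R) :
  0 < rho < 1 -> (forall i, L2 B (f i)) -> (forall i j, L2 B (g i j)) ->
  (forall i, c i = avg (eball n rho) (f i)) ->
  (forall i j, S i j = 2^-1 * avg (eball n rho) (fun x => g i j x - g j i x)) ->
  \sum_i sqint B (affine (c i) (S i)) + \sum_i \sum_j sqint B (cst (S i j)) <=
  (n%:R + 3) / (n%:R + 2) * rho^-1 ^+ n *
    (\sum_i sqint B (f i) + \sum_i \sum_j sqint B (g i j)).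
Proof.
move=> /andP[r0 r1] Lf Lg cE SE; set V := fine (mu B).
have mr := measurable_eball n rho; have roo := lebesgue_eball_lty n rho.
have rB : eball n rho `<=` B by move=> x /= xr; exact: lt_trans xr r1.
have V0 : 0 <= V by exact: fine_ge0.
have VrE : fine (mu (eball n rho)) = rho ^+ n * V.
  by rewrite lebesgue_eball_scale// fineM// ge0_fin_numE.
(* An inequality, so as to cover a null ball, where the left side is [0]. *)
have VW : V * (rho ^+ n * V)^-1 <= rho^-1 ^+ n.
  have [->|Vn] := eqVneq V 0; first by rewrite mul0r exprn_ge0// invr_ge0 ltW.
  by rewrite invfM mulrCA mulfV// mulr1 exprVn.
have L h : L2 B h -> V * avg (eball n rho) h ^+ 2 <= rho^-1 ^+ n * sqint B h.
  move=> Lh; have := avg_sqr_le mr roo (L2S mB mr rB Lh).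
  rewrite VrE => /(ler_wpM2l V0)/le_trans; apply; rewrite mulrA.
  by apply: ler_pM => //; [rewrite mulr_ge0// invr_ge0 mulr_ge0// exprn_ge0// ltW
    |exact: sqint_ge0|exact: sqintS].
(* With weight [1] the integral of [(g_ij - g_ji)^2] is at most twice the sum of the two squared
   norms, and the squared factor [1/2] leaves their mean. Summed over [i] and [j], these means give
   back the full sum. *)
have HS i j : V * S i j ^+ 2 <=
    rho^-1 ^+ n * (2^-1 * (sqint B (g i j) + sqint B (g j i))).
  rewrite SE exprMn mulrCA; have := L _ (L2B mB (Lg i j) (Lg j i)) => H.
  have := sqintB_le mB ltr01 (Lg i j) (Lg j i); rewrite invr1 => H2.
  have r0n : 0 <= rho^-1 ^+ n by rewrite exprn_ge0// invr_ge0 ltW.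
  have := ler_wpM2l r0n H2; move: H; lra.
have kE : (n%:R + 3) / (n%:R + 2) = 1 + (n%:R + 2)^-1 :> R.
  by field; rewrite gt_eqF// ltr_wpDl.
have k1 : 1 <= (n%:R + 3) / (n%:R + 2) :> R by rewrite kE lerDl invr_ge0 addr_ge0.
under eq_bigr do rewrite sqint_affine.
have E i j : sqint B (cst (S i j)) = V * S i j ^+ 2.
  by rewrite [RHS]mulrC; have := Rintegral_cst mu mB (S i j ^+ 2).
under [X in _ + X <= _]eq_bigr do under eq_bigr do rewrite E.
rewrite -/V.
have -> : \sum_i V * (c i ^+ 2 + (\sum_k S i k ^+ 2) / (n%:R + 2)) +
    \sum_i \sum_j V * S i j ^+ 2 =
    \sum_i V * c i ^+ 2 + (n%:R + 3) / (n%:R + 2) * \sum_i \sum_j V * S i j ^+ 2.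
  under eq_bigr do rewrite mulrDr.
  rewrite big_split/= -addrA kE mulrDl mul1r; congr (_ + _).
  rewrite addrC; congr (_ + _); rewrite mulr_sumr; apply: eq_bigr => i _.
  by rewrite -mulr_sumr; ring.
(* The translation part is bounded with constant [1], which is then enlarged to
   [(n + 3) / (n + 2)]. *)
rewrite -[leRHS]mulrA [X in _ <= _ * X]mulrDr [leRHS]mulrDr; apply: lerD.
  apply: (@le_trans _ _ (rho^-1 ^+ n * \sum_i sqint B (f i))).
    by rewrite mulr_sumr; apply: ler_sum => i _; rewrite cE; exact: L.
  rewrite ler_peMl//; apply: mulr_ge0; first by rewrite exprn_ge0// invr_ge0 ltW.
  by apply: sumr_ge0 => i _; exact: sqint_ge0.
apply: ler_wpM2l; first exact: le_trans ler01 k1.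
apply: (@le_trans _ _ (\sum_i \sum_j
    rho^-1 ^+ n * (2^-1 * (sqint B (g i j) + sqint B (g j i))))).
  by apply: ler_sum => i _; apply: ler_sum => j _; exact: HS.
under eq_bigr do rewrite -mulr_sumr -mulr_sumr big_split/=.
rewrite -mulr_sumr -mulr_sumr big_split/= [X in _ + X]exchange_big/=.
by rewrite le_eqVlt; apply/orP; left; apply/eqP; field.
Qed.

Lemma rigid_proj_W12v r u : 0 < r -> W12v B (rigid_proj B (eball n r) u).
Proof.
move=> r0 i; under eq_fun do rewrite rigid_projE//; exact: affine_W12.
Qed.

Lemma W12norm_rigid_proj_le (rho : R) u : 0 < rho < 1 -> W12v B u ->
  W12norm B (rigid_proj B (eball n rho) u) ^+ 2 <=
  (n%:R + 3) / (n%:R + 2) * rho^-1 ^+ n * W12norm B u ^+ 2.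
Proof.
move=> rho01 Wu; have /andP[r0 r1] := rho01.
have Lu i : L2 B (fun x => u x i ord0) by case: (Wu i).
pose D i j := weak_partial B (fun x => u x i ord0) j.
have LD i j : L2 B (D i j) := (W12_weak_partial j (Wu i)).1.
have wD i j : is_weak_partial B (fun x => u x i ord0) j (D i j) :=
  (W12_weak_partial j (Wu i)).2.
rewrite [X in _ <= _ * X](@W12norm_sqr _ _ _ u D Lu LD wD).
have TE i : (fun x => rigid_proj B (eball n rho) u x i ord0) =
    affine (avg (eball n rho) (fun y => u y i ord0)) (avg_skew_grad B (eball n rho) u i).
  by apply/funext => x; exact: rigid_projE.
rewrite [leLHS](@W12norm_sqr _ _ _ _ (fun i j => cst (avg_skew_grad B (eball n rho) u i j))).
- under eq_bigr do rewrite TE.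
  by apply: sum_sqint_rigid_le => // i j; exact: avg_skew_gradE.
- by move=> i; rewrite TE; exact: affine_L2.
- by move=> i j; exact: L2_cst.
- by move=> i j; rewrite TE; exact: weak_partial_affine.
Qed.

End rigid_projection.

(** * The error estimate for [u - T u] *)

Section projection_error.
Context {R : realType} {n : nat}.
Notation mu := (@lebesgue_cV R n).
Notation B := (eball n (1 : R)).

Let mB : measurable B := measurable_eball n 1.
Let Boo : (mu B < +oo)%E := lebesgue_eball_lty n 1.

Lemma avgB (F : set 'cV[R]_n) f g : measurable F ->
  mu.-integrable F (EFin \o f) -> mu.-integrable F (EFin \o g) ->
  avg F (fun x => f x - g x) = avg F f - avg F g.
Proof. by move=> mF fi gi; rewrite /avg RintegralB// mulrBr. Qed.

Lemma avg_cst (F : set 'cV[R]_n) a : measurable F -> fine (mu F) != 0 ->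
  avg F (cst a) = a.
Proof. by move=> mF F0; rewrite /avg Rintegral_cst// mulrCA mulVf// mulr1. Qed.

(** Subtracting a constant matrix with entries [s] at [(i, j)] and [t = - s] at [(j, i)] lowers the
    averaged skew part by [(s - t) / 2 = s]. *)
Lemma avg_skew_sub (F : set 'cV[R]_n) f g (s t : R) : measurable F ->
  (mu F < +oo)%E -> fine (mu F) != 0 ->
  mu.-integrable F (EFin \o f) -> mu.-integrable F (EFin \o g) -> t = - s ->
  2^-1 * avg F (fun x => (f x - s) - (g x - t)) =
  2^-1 * avg F (fun x => f x - g x) - s.
Proof.
move=> mF Foo F0 fi gi ->.
have ic a : mu.-integrable F (EFin \o cst a) by apply: L2_integrable => //; exact: L2_cst.
have is' := integrableB mF fi (ic s); have it := integrableB mF gi (ic (- s)).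
rewrite (avgB mF is' it) (avgB mF fi (ic s)) (avgB mF gi (ic (- s))) (avgB mF fi gi).
by rewrite !avg_cst//; field.
Qed.

Lemma sqint_null f : fine (mu B) = 0 -> L2 B f -> sqint B f = 0.
Proof.
move=> V0 Lf; have muB0 : mu B = 0%E by rewrite -[LHS]fineK ?V0// ge0_fin_numE.
by rewrite /sqint /Rintegral (null_set_integral mB (measurable_int _ (L2_integrable_sqr mB Lf)) muB0).
Qed.

(* [v] and [g] below are [v = u - P u] and its gradient.  The case [|B| = 0] is
   treated separately, since averages over a null set are junk. *)
Lemma W12norm_sub_rigid_proj_le (rho Q K C : R) (u : 'cV[R]_n -> 'cV[R]_n) :
  0 < rho < 1 -> 0 <= Q -> 0 <= K -> 0 < C ->
  C ^+ 2 = (n%:R + 3) / (n%:R + 2) * rho^-1 ^+ n ->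
  (forall f, W12 B f -> L2norm B (fun x => f x - avg B f) <=
     Q * L2norm_mx B (weak_grad B f)) ->
  L2norm_mx B (fun x => weak_gradv B u x - avg_skew_grad B B u) <=
     K * L2norm_mx B (sym_grad B u) ->
  W12v B u ->
  W12norm B (fun x => u x - rigid_proj B (eball n rho) u x) <=
    (1 + C) * K * Num.sqrt (1 + Q ^+ 2) * L2norm_mx B (sym_grad B u).
Proof.
move=> rho01 Q0 K0 C0 CE Poincare Korn Wu; have /andP[r0 r1] := rho01.
set e := L2norm_mx B (sym_grad B u); set F := eball n rho.
have mF : measurable F := measurable_eball n rho.
have FB : F `<=` B by move=> x /= xr; exact: lt_trans xr r1.
have Foo : (mu F < +oo)%E := lebesgue_eball_lty n rho.
have e0 : 0 <= e by exact: sqrtr_ge0.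
pose ui i := fun x => u x i ord0.
pose D i j := weak_partial B (ui i) j.
have Lu i : L2 B (ui i) by case: (Wu i).
have LD i j : L2 B (D i j) := (W12_weak_partial j (Wu i)).1.
have wD i j : is_weak_partial B (ui i) j (D i j) := (W12_weak_partial j (Wu i)).2.
(* [c1] and [S1] are the coefficients of [P u]; below, [c] and [S] are those of [T v], and [Su] is
   the matrix of [T u]. *)
pose c1 i := avg B (ui i); pose S1 := avg_skew_grad B B u.
pose v i x := ui i x - affine (c1 i) (S1 i) x.
pose g i j x := D i j x - S1 i j.
have Lc (a : R) : L2 B (cst a) by exact: L2_cst.
have Lv i : L2 B (v i) by exact: (L2B mB (Lu i) (affine_L2 _ _)).
have Lg i j : L2 B (g i j) by exact: (L2B mB (LD i j) (Lc _)).
have wB f f' c w j : L2 B f -> L2 B f' -> is_weak_partial B f j f' ->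
    is_weak_partial B (fun x => f x - affine c w x) j (fun x => f' x - w j).
  move=> Lf Lf' wf.
  exact: (is_weak_partialB Lf (affine_L2 c w) Lf' (Lc (w j)) wf
    (@weak_partial_affine _ _ c w j)).
have wg i j : is_weak_partial B (v i) j (g i j) by exact: (wB _ _ _ (S1 i)).
pose c i := avg F (v i); pose S i j := 2^-1 * avg F (fun x => g i j x - g j i x).
pose Su := avg_skew_grad B F u.
pose w i x := ui i x - affine (avg F (ui i)) (Su i) x.
have wE i : (fun x => (u x - rigid_proj B F u x) i ord0) = w i.
  by apply/funext => x; rewrite mxE [X in _ + X]mxE rigid_projE.
have Lw i : L2 B (w i) by exact: (L2B mB (Lu i) (affine_L2 _ _)).
have Lgs i j : L2 B (fun x => D i j x - Su i j) by exact: (L2B mB (LD i j) (Lc _)).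
have ww i j : is_weak_partial B (w i) j (fun x => D i j x - Su i j).
  exact: (wB _ _ _ (Su i)).
have NE : W12norm B (fun x => u x - rigid_proj B F u x) ^+ 2 =
    \sum_i sqint B (w i) + \sum_i \sum_j sqint B (fun x => D i j x - Su i j).
  rewrite [LHS](@W12norm_sqr _ _ _ _ (fun i j x => D i j x - Su i j)) => [|i|//|i j].
  - by congr (_ + _); apply: eq_bigr => i _; rewrite wE.
  - by rewrite wE.
  - by rewrite wE.
have rhs0 : 0 <= (1 + C) * K * Num.sqrt (1 + Q ^+ 2) * e.
  apply: mulr_ge0 => //; apply: mulr_ge0; last exact: sqrtr_ge0.
  by apply: mulr_ge0 => //; rewrite addr_ge0// ltW.
rewrite -(@ler_pXn2r _ 2%N) ?nnegrE ?sqrtr_ge0//.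
have [V0|V0] := eqVneq (fine (mu B)) 0.
  rewrite NE big1 => [|i _]; last exact: sqint_null.
  rewrite big1 ?addr0 ?exprn_ge0// => i _.
  by rewrite big1// => j _; exact: sqint_null.
have VF0 : fine (mu F) != 0.
  rewrite lebesgue_eball_scale// fineM// ?ge0_fin_numE//.
  by rewrite mulf_neq0// gt_eqF// exprn_gt0.
have int h : L2 B h -> mu.-integrable F (EFin \o h).
  by move=> Lh; apply: L2_integrable => //; exact: (L2S mB mF FB).
(* [cE] and [SE] together say [T v = T u - P u], as [T] fixes [P u]; [wvE] and [gE] then express
   [u - T u = v - T v] and its gradient. *)
have cE i : c i = avg F (ui i) - c1 i.
  rewrite /c (avgB mF (int _ (Lu i)) (int _ (affine_L2 (c1 i) (S1 i)))).
  by rewrite avg_affine.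
have SE i j : S i j = Su i j - S1 i j.
  rewrite /Su avg_skew_gradE.
  apply: (avg_skew_sub mF Foo VF0 (int _ (LD i j)) (int _ (LD j i))).
  exact: avg_skew_grad_antisym.
have wvE i : w i = fun x => v i x - affine (c i) (S i) x.
  apply/funext => x; rewrite /w /v /affine cE.
  have -> : \sum_k S i k * x k ord0 = \sum_k Su i k * x k ord0
      - \sum_k S1 i k * x k ord0.
    by rewrite -sumrB; apply: eq_bigr => k _; rewrite SE mulrBl.
  by ring.
have gE i j : (fun x => D i j x - Su i j) = fun x => g i j x - S i j.
  by apply/funext => x; rewrite SE /g; ring.
pose Na := \sum_i sqint B (v i) + \sum_i \sum_j sqint B (g i j).
pose Nb := \sum_i sqint B (affine (c i) (S i)) + \sum_i \sum_j sqint B (cst (S i j)).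
have NbE : Nb <= C ^+ 2 * Na by rewrite CE; exact: sum_sqint_rigid_le.
have N1 : W12norm B (fun x => u x - rigid_proj B F u x) ^+ 2 <=
    (1 + C) * Na + (1 + C^-1) * Nb.
  rewrite NE /Na /Nb !mulrDr addrACA.
  apply: lerD; rewrite !mulr_sumr -big_split/=; apply: ler_sum => i _.
    by rewrite wvE; exact: (sqintB_le mB C0 (Lv i) (affine_L2 _ _)).
  rewrite !mulr_sumr -big_split/=; apply: ler_sum => j _.
  by rewrite gE; exact: (sqintB_le mB C0 (Lg i j) (Lc _)).
have N2 : W12norm B (fun x => u x - rigid_proj B F u x) ^+ 2 <= (1 + C) ^+ 2 * Na.
  apply: (le_trans N1).
  have iC : 0 <= 1 + C^-1 by rewrite addr_ge0// invr_ge0 ltW.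
  have := ler_wpM2l iC NbE.
  have -> : (1 + C^-1) * (C ^+ 2 * Na) = (C ^+ 2 + C) * Na.
    by field; rewrite gt_eqF.
  by move=> H; apply: (le_trans (lerD (lexx _) H)); rewrite -mulrDl;
    rewrite le_eqVlt; apply/orP; left; apply/eqP; ring.
(* [v] has mean zero over the ball, so Poincare bounds [v] itself. *)
have Pv i : sqint B (v i) <= Q ^+ 2 * \sum_j sqint B (g i j).
  have Wv : W12 B (v i) by split=> // j; exists (g i j).
  have av : avg B (v i) = 0.
    rewrite /v (avgB mB (L2_integrable mB Boo (Lu i))
      (L2_integrable mB Boo (affine_L2 (c1 i) (S1 i)))).
    by rewrite avg_affine// subrr.
  have := Poincare _ Wv; rewrite av.
  rewrite (_ : (fun x => v i x - 0) = v i); last by apply/funext => x; rewrite subr0.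
  rewrite -(@ler_pXn2r _ 2%N) ?nnegrE ?mulr_ge0 ?sqrtr_ge0//.
  rewrite exprMn (L2norm_grad_sqr (Lg i) (wg i)) sqr_sqrtr//.
  exact: sqint_ge0.
have KE : \sum_i \sum_j sqint B (g i j) <= K ^+ 2 * e ^+ 2.
  move: Korn; rewrite -/e -(@ler_pXn2r _ 2%N) ?nnegrE ?mulr_ge0 ?sqrtr_ge0//.
  have E i j : (fun x => (weak_gradv B u x - avg_skew_grad B B u) i j) = g i j.
    by apply/funext => x; rewrite mxE [X in X + _]mxE [X in _ + X]mxE.
  rewrite exprMn [leLHS]L2norm_mx_sqr//; last by move=> i j; rewrite E.
  apply: le_trans; rewrite le_eqVlt; apply/orP; left; apply/eqP.
  by apply: eq_bigr => i _; apply: eq_bigr => j _; rewrite E.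
have NaE : Na <= (1 + Q ^+ 2) * (K ^+ 2 * e ^+ 2).
  apply: (@le_trans _ _ ((1 + Q ^+ 2) * \sum_i \sum_j sqint B (g i j))); last first.
    by rewrite ler_wpM2l// addr_ge0// sqr_ge0.
  rewrite /Na addrC mulrDl mul1r lerD2l mulr_sumr.
  by apply: ler_sum => i _; exact: Pv.
apply: (le_trans N2); apply: (le_trans (ler_wpM2l (sqr_ge0 (1 + C)) NaE)).
rewrite !exprMn (@sqr_sqrtr _ (1 + Q ^+ 2)) ?addr_ge0 ?sqr_ge0//.
by rewrite le_eqVlt; apply/orP; left; apply/eqP; ring.
Qed.

End projection_error.

Theorem mainTheorem5 (R : realType) (n : nat) (hn : (0 < n)%N)
  (rho Q K : R) (hrho : 0 < rho < 1) (hQ : 0 < Q) (hK : 0 < K)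
  (Poincare : forall u : 'cV[R]_n -> R, W12 (eball n 1) u ->
     L2norm (eball n 1) (fun x => u x - avg (eball n 1) u)
       <= Q * L2norm_mx (eball n 1) (weak_grad (eball n 1) u))
  (Korn : forall u : 'cV[R]_n -> 'cV[R]_n, W12v (eball n 1) u ->
     L2norm_mx (eball n 1) (fun x => weak_gradv (eball n 1) u x
                                - avg_skew_grad (eball n 1) (eball n 1) u)
       <= K * L2norm_mx (eball n 1) (sym_grad (eball n 1) u)) :
  let T := rigid_proj (eball n 1) (eball n rho) in
  let C := Num.sqrt ((n%:R + 3) / (n%:R + 2)) * (1 / rho) `^ (n%:R / 2) in
  [/\ forall u : 'cV[R]_n -> 'cV[R]_n,
        W12v (eball n 1) u -> W12v (eball n 1) (T u),
      (W12opnorm (eball n 1) T <= C%:E)%E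
    & forall u : 'cV[R]_n -> 'cV[R]_n, W12v (eball n 1) u ->
        W12norm (eball n 1) (fun x => u x - T u x)
          <= (1 + C) * K * Num.sqrt (1 + Q ^+ 2)
             * L2norm_mx (eball n 1) (sym_grad (eball n 1) u)].
Proof.
move=> T C; have /andP[r0 r1] := hrho.
have ri : 0 < 1 / rho by rewrite mul1r invr_gt0.
have n3 : 0 < (n%:R + 3) / (n%:R + 2) :> R by rewrite divr_gt0// ltr_wpDl.
have C0 : 0 < C by rewrite mulr_gt0 ?sqrtr_gt0// powR_gt0.
(* Squaring turns the real power with exponent [n / 2] into the natural power in which the estimates
   are stated. *)
have CE : C ^+ 2 = (n%:R + 3) / (n%:R + 2) * rho^-1 ^+ n.
  rewrite exprMn sqr_sqrtr ?ltW//; congr (_ * _).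
  by rewrite -powR_mulrn ?powR_ge0// -powRrM mulfVK// powR_mulrn ?ltW// mul1r.
split=> [u Wu||u Wu].
- exact: rigid_proj_W12v.
- apply: ge_ereal_sup => _ [u [Wu u1] <-]; rewrite lee_fin.
  rewrite -(@ler_pXn2r _ 2%N) ?nnegrE ?sqrtr_ge0// ?(ltW C0)//.
  apply: (le_trans (W12norm_rigid_proj_le hrho Wu)); rewrite -CE.
  by rewrite ler_piMr ?sqr_ge0// exprn_ile1// sqrtr_ge0.
- exact: (W12norm_sub_rigid_proj_le hrho (ltW hQ) (ltW hK) C0 CE Poincare
    (Korn u Wu) Wu).
Qed.
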